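(* Let $\mathbb{M}\in\{\mathbb{E}^d,\mathbb{H}^d\}$, $d\ge2$, and let $B\subset\mathbb{M}$ be a ball. Among all $d$-dimensional simplices in $\mathbb{M}$ containing $B$, the ones with minimal volume are exactly the regular simplices circumscribed about $B$.
   Context: A regular simplex has all edges of equal length. A simplex is circumscribed about the ball $B$ if it contains $B$ and every facet of it touches $B$ (equivalently, $B$ is its inscribed ball). Convexity in $\mathbb{H}^d$ is with respect to hyperbolic geodesic segments. *)

(* Defs.v *)
From HB Require Import structures.
From mathcomp Require Import all_boot all_order all_algebra.
From mathcomp Require Import all_classical all_reals all_analysis.
Set Implicit Arguments. Unset Strict Implicit. Unset Printing Implicit Defensive.
Import Order.TTheory GRing.Theory Num.Theory.
Local Open Scope classical_set_scope.
Local Open Scope ring_scope.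

(* The two model spaces: Euclidean space E^d = R^d, and hyperbolic space H^d
   in the Beltrami–Klein (projective) model: the open unit ball of R^d.
   In the Klein model hyperbolic geodesics are Euclidean straight segments. *)
Inductive geometry := Euclidean | Hyperbolic.

Section Defs.
Variable R : realType.

Definition dotv (d : nat) (u v : 'rV[R]_d) : R := (u *m v^T) 0 0.
Definition sqn (d : nat) (u : 'rV[R]_d) : R := dotv u u.

Definition in_space (g : geometry) (d : nat) (x : 'rV[R]_d) : Prop :=
  match g with Euclidean => True | Hyperbolic => sqn x < 1 end.

Definition acosh (t : R) : R := ln (t + Num.sqrt (t ^+ 2 - 1)).

Definition gdist (g : geometry) (d : nat) (x y : 'rV[R]_d) : R :=
  match g with
  | Euclidean => Num.sqrt (sqn (x - y))
  | Hyperbolic =>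
      acosh ((1 - dotv x y) / Num.sqrt ((1 - sqn x) * (1 - sqn y)))
  end.

Definition gball (g : geometry) (d : nat) (c : 'rV[R]_d) (r : R) : set 'rV[R]_d :=
  [set x | in_space g x /\ gdist g c x <= r].

(* d-dimensional Lebesgue integral of a nonnegative function, as an iterated
   integral of one-dimensional Lebesgue integrals (Tonelli). *)
Fixpoint iint (n : nat) : ('rV[R]_n -> \bar R) -> \bar R :=
  match n return ('rV[R]_n -> \bar R) -> \bar R with
  | 0 => fun f => f 0
  | n'.+1 => fun f =>
      (\int[@lebesgue_measure R]_x iint (fun v : 'rV[R]_n' => f (row_mx (x%:M) v)))%E
  end.

Definition density (g : geometry) (d : nat) (x : 'rV[R]_d) : R :=
  match g with
  | Euclidean => 1
  | Hyperbolic => powR (1 - sqn x) (- ((d.+1)%:R / 2))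
  end.

Definition gvol (g : geometry) (d : nat) (A : set 'rV[R]_d) : \bar R :=
  iint (fun x => (\1_A x * density g x)%:E).

Definition convex_comb (d : nat) (v : 'I_d.+1 -> 'rV[R]_d) (t : 'I_d.+1 -> R) :=
  \sum_(i < d.+1) t i *: v i.

Definition is_weights (d : nat) (t : 'I_d.+1 -> R) : Prop :=
  (forall i, 0 <= t i) /\ \sum_(i < d.+1) t i = 1.

(* the (geodesic = straight-line) convex hull of the vertices *)
Definition simplex_set (d : nat) (v : 'I_d.+1 -> 'rV[R]_d) : set 'rV[R]_d :=
  [set x | exists t, is_weights t /\ x = convex_comb v t].

Definition facet (d : nat) (v : 'I_d.+1 -> 'rV[R]_d) (j : 'I_d.+1) : set 'rV[R]_d :=
  [set x | exists t, is_weights t /\ t j = 0 /\ x = convex_comb v t].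

Definition is_simplex (g : geometry) (d : nat) (v : 'I_d.+1 -> 'rV[R]_d) : Prop :=
  (forall i, in_space g (v i)) /\
  row_free (\matrix_(i < d) (v (lift ord0 i) - v ord0)).

Definition regular (g : geometry) (d : nat) (v : 'I_d.+1 -> 'rV[R]_d) : Prop :=
  forall i j k l, i != j -> k != l -> gdist g (v i) (v j) = gdist g (v k) (v l).

Definition circumscribed (d : nat) (v : 'I_d.+1 -> 'rV[R]_d)
    (B : set 'rV[R]_d) : Prop :=
  B `<=` simplex_set v /\ forall j, facet v j `&` B !=set0.

End Defs.

(* Main.v *)
From HB Require Import structures.
Require Import Defs.
From mathcomp Require Import all_boot all_order all_algebra all_fingroup.
From mathcomp Require Import all_classical all_reals all_analysis.
From mathcomp Require Import measurable_realfun ring lra.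
Set Implicit Arguments. Unset Strict Implicit. Unset Printing Implicit Defensive.
Import Order.TTheory GRing.Theory Num.Theory.
Import numFieldNormedType.Exports.
Local Open Scope classical_set_scope.
Local Open Scope ring_scope.

(* Put [q(y) = y_0^2 - k |y'|^2] on [R^(1+d)], with [k = 0] in the Euclidean and
   [k = 1] in the hyperbolic case. Up to a constant depending only on [d], the volume of
   the simplex with vertices [v_i] is the integral of [max(0, 1 - q)] over the cone
   spanned by the vectors [(1, v_i)], that is [|det W|] times the integral of
   [max(0, 1 - q(s W))] over the orthant [s >= 0], where [W] has the rows [(1, v_i)].
   This is invariant under linear maps preserving [q], so the ball may be assumed to be
   centred at the origin, say of radius [rho].

   The barycentric coordinates [a_i + <b_i, x>] are nonnegative on the ball iff
   [rho |b_i| <= a_i], and [W^-1] has the columns [(a_i, b_i)]. Hadamard's inequality for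
   the rows [(a_i, sqrt d rho b_i)] and the AM-GM inequality for the [a_i] give
   [det W ^ 2 >= (d rho^2)^d (d+1)^(d+1)], with equality only for the regular
   circumscribed simplex, and [<b_i, v_i> = 1 - a_i] gives
   [sum |v_i|^2 >= (d+1) d^2 rho^2], again attained by the regular simplex. Since
   [max(0, 1 - q)] is convex and decreasing in [q], averaging over the permutations of [s]
   and inserting the second bound shows that the integral over the orthant is also
   smallest for the regular simplex. *)

(** * Iterated Lebesgue integrals *)

Section lint.
Variable R : realType.
Local Notation mu := (@lebesgue_measure R).

(** The two factors [|det W|] and the integral over the orthant are bounded independently, which
    succeeds because both are smallest at the same simplex. For [k = 0] the second factor does not
    depend on [W] at all. The equality case is read off the determinant alone; the other factor only
    has to be positive and finite, so that it can be cancelled.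

    The profile [max(0, 1 - t)] is a choice. Along the ray through [(1, x)], a function of [q]
    integrated against [u ^ d] gives a constant times [(1 - k |x|^2) ^ (- (d + 1) / 2)], which is
    the volume density, by scaling alone. This profile is convex, as Jensen's inequality requires,
    decreasing, so that an upper bound on [q] is enough, and zero from 1 on, so that only a bounded
    part of the cone counts.

    Averaging is needed because only the sum of the [|v_i|^2] is controlled, not the single scalar
    products: after it, [q] sees just the trace of the Gram matrix and [|sum v_i|^2], and the latter
    may be dropped.

    Minimality and regularity meet in a prescribed Gram matrix, the same for both geometries. *)

Lemma integral_affine (f : R -> \bar R) (a b : R) : a != 0 ->
  measurable_fun [set: R] f -> (forall x, 0 <= f x)%E ->
  (`|a|%:E * \int[mu]_x f (a * x + b)%R = \int[mu]_x f x)%E.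
Proof.
move=> a0 mf f0.
pose phi : measurableTypeR R -> measurableTypeR R := fun x => a * x + b.
have mphi : measurable_fun setT phi.
  by apply: measurable_funD => //; apply: measurable_funM.
pose phiM : {mfun measurableTypeR R >-> measurableTypeR R} :=
  HB.pack phi (isMeasurableFun.Build _ _ _ _ _ mphi).
pose k : {nonneg R} := NngNum (normr_ge0 a).
(* [|a|] times the image of Lebesgue measure under [x |-> a x + b] has the right value on half-open
   intervals, so it is Lebesgue measure by uniqueness. *)
have [nu [key nuE]] : exists nu : {measure set (measurableTypeR R) -> \bar R},
    (forall A, measurable A -> mu A = nu A) /\
    (\int[nu]_x f x = `|a|%:E * \int[mu]_x f (a * x + b)%R)%E.
  unshelve eexists (mscale k (pushforward mu phiM)); first exact: mphi.
  split; last by rewrite ge0_integral_mscale//= ge0_integral_pushforward.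
  apply: lebesgue_measure_unique => X [[x y] _ <-].
  change (mu `]x, y] = `|a|%:E * mu (phi @^-1` `]x, y]))%E.
  have [a_gt0|a_lt0|a00] := ltgtP 0 a; last by rewrite -a00 eqxx in a0.
  - rewrite [X in (_ * mu X)%E](_ : _ = `](x - b) / a, (y - b) / a]%classic); last first.
      apply/seteqP; split=> z /=; rewrite !in_itv /= /phi ltr_pdivrMr// ler_pdivlMr// ltrBlDr lerBrDr mulrC//.
    rewrite !lebesgue_measure_itv /= !lte_fin ltr_pM2r ?invr_gt0// ltrD2r.
    case: ifPn => _; last by rewrite mule0.
    rewrite gtr0_norm// -!EFinB -EFinM; congr (_%:E).
    by rewrite -mulrBl mulrCA mulfV// mulr1; ring.
  - rewrite [X in (_ * mu X)%E](_ : _ = `[(y - b) / a, (x - b) / a[%classic); last first.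
      apply/seteqP; split=> z /=; rewrite !in_itv /= /phi ltr_ndivlMr// ler_ndivrMr// ltrBlDr lerBrDr mulrC andbC//.
    rewrite !lebesgue_measure_itv /= !lte_fin ltr_nM2r ?invr_lt0// ltrD2r.
    case: ifPn => _; last by rewrite mule0.
    rewrite ltr0_norm// -!EFinB -EFinM; congr (_%:E).
    by rewrite -mulrBl mulrCA mulNr mulfV// mulrN1; ring.
by rewrite -nuE; apply: eq_measure_integral => A mA _; rewrite -key.
Qed.

End lint.

Section iint.
Variable R : realType.
Local Notation mu := (@lebesgue_measure R).

(* No sigma-algebra on ['rV[R]_n] is needed: a function counts as measurable when its
   composition with every coordinatewise measurable map is, and this is stable under
   integrating out the first coordinate. *)
Definition measurable_row d (T : measurableType d) n (h : T -> 'rV[R]_n) :=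
  forall i, measurable_fun setT (fun t => h t 0 i).

Definition measurable_family d (T : measurableType d) n
    (F : T -> 'rV[R]_n -> \bar R) :=
  forall d' (T' : measurableType d') (k : T' -> T) (h : T' -> 'rV[R]_n),
    measurable_fun setT k -> measurable_row h ->
    measurable_fun setT (fun t => F (k t) (h t)).

Definition measurable_on_rV n (f : 'rV[R]_n -> \bar R) :=
  forall d (T : measurableType d) (h : T -> 'rV[R]_n),
    measurable_row h -> measurable_fun setT (fun t => f (h t)).

Lemma row_mx_head n (x : R) (v : 'rV[R]_n) (j : 'I_1) :
  (row_mx x%:M v : 'rV[R]_n.+1) 0 (lshift n j : 'I_n.+1) = x.
Proof. by rewrite (row_mxEl (x%:M : 'M[R]_1)) mxE ord1 eqxx mulr1n. Qed.

Lemma row_mx_tail n (x : R) (v : 'rV[R]_n) (j : 'I_n) :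
  (row_mx x%:M v : 'rV[R]_n.+1) 0 (rshift 1 j : 'I_n.+1) = v 0 j.
Proof. exact: (row_mxEr (x%:M : 'M[R]_1)). Qed.

Lemma measurable_row_mx d (T : measurableType d) n (x : T -> R) (h : T -> 'rV[R]_n) :
  measurable_fun setT x -> measurable_row h ->
  @measurable_row _ _ n.+1 (fun t => row_mx (x t)%:M (h t)).
Proof.
move=> mx mh i; have [j ->|j ->] := @split_ordP 1 n i.
  by under eq_fun do rewrite row_mx_head.
by under eq_fun do rewrite row_mx_tail; exact: mh.
Qed.

Lemma measurable_row_tail d (T : measurableType d) n (h : T -> 'rV[R]_n.+1) :
  measurable_row h -> measurable_row (fun t => @rsubmx R 1 1 n (h t)).
Proof. by move=> mh i; under eq_fun do rewrite mxE; exact: mh. Qed.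

Lemma measurable_row_mul d (T : measurableType d) n m (h : T -> 'rV[R]_n) (A : 'M[R]_(n, m)) :
  measurable_row h -> measurable_row (fun t => h t *m A).
Proof.
move=> mh i; under eq_fun do rewrite mxE.
by apply: measurable_sum => j; apply: measurable_funM.
Qed.

Lemma measurable_row_cst d (T : measurableType d) n (a : 'rV[R]_n) :
  measurable_row (fun _ : T => a).
Proof. by move=> i; exact: measurable_cst. Qed.

Lemma measurable_on_rV_family d (T : measurableType d) n m (f : 'rV[R]_m -> \bar R) (g : T -> 'rV[R]_n -> 'rV[R]_m) :
  (forall d' (T' : measurableType d') (k : T' -> T) (h : T' -> 'rV[R]_n),
    measurable_fun setT k -> measurable_row h ->
    measurable_row (fun t => g (k t) (h t))) ->
  measurable_on_rV f -> measurable_family (fun x v => f (g x v)).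
Proof. by move=> mg mf d' T' k h mk mh; apply: mf; exact: mg. Qed.

Lemma measurable_on_rV_cons n (f : 'rV[R]_n.+1 -> \bar R) :
  measurable_on_rV f ->
  measurable_family (fun (x : R) (v : 'rV[R]_n) => f (row_mx x%:M v)).
Proof.
by move=> mf; apply: measurable_on_rV_family mf => *; exact: measurable_row_mx.
Qed.

Lemma measurable_family_at d (T : measurableType d) n (F : T -> 'rV[R]_n -> \bar R) x :
  measurable_family F -> measurable_on_rV (F x).
Proof. by move=> mF d' T' h mh; apply: mF => //; exact: measurable_cst. Qed.

Lemma measurable_on_rV_at n (f : 'rV[R]_n.+1 -> \bar R) x :
  measurable_on_rV f -> measurable_on_rV (fun v : 'rV[R]_n => f (row_mx x%:M v)).
Proof. by move=> /measurable_on_rV_cons /measurable_family_at; exact. Qed.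

Lemma iint_ge0 n (f : 'rV[R]_n -> \bar R) : (forall x, 0 <= f x)%E -> (0 <= iint f)%E.
Proof.
elim: n f => [|n IH] f f0 /=; first exact: f0.
by apply: integral_ge0 => x _; exact: IH.
Qed.

(** The induction moves the first coordinate into the parameter space, so each step only asks for
    measurability of a partial integral on a product of two spaces. This is why the parameter ranges
    over an arbitrary measurable type. *)
Lemma measurable_iint n d (T : measurableType d) (F : T -> 'rV[R]_n -> \bar R) :
  measurable_family F -> (forall t v, 0 <= F t v)%E ->
  measurable_fun setT (fun t => iint (F t)).
Proof.
elim: n d T F => [|n IH] d T F mF F0 /=.
  by apply: mF => //; exact: measurable_row_cst.
pose G (p : T * measurableTypeR R) := iint (fun v : 'rV[R]_n => F p.1 (row_mx p.2%:M v)).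
apply: (@measurable_fun_fubini_tonelli_F _ _ T (measurableTypeR R) R mu G).
  have /= := IH _ _ (fun (p : T * measurableTypeR R) (v : 'rV[R]_n) => F p.1 (row_mx p.2%:M v)).
  apply => //.
  move=> d' T' k h mk mh; apply: mF.
    exact: (measurableT_comp measurable_fst mk).
  by apply: measurable_row_mx => //; exact: (measurableT_comp measurable_snd mk).
by move=> p; apply: iint_ge0.
Qed.

Lemma measurable_iint_cons n (f : 'rV[R]_n.+1 -> \bar R) :
  measurable_on_rV f -> (forall v, 0 <= f v)%E ->
  measurable_fun [set: R] (fun x : R => iint (fun v : 'rV[R]_n => f (row_mx x%:M v))).
Proof. by move=> mf f0; apply: measurable_iint => //; exact: measurable_on_rV_cons. Qed.

Lemma iint_tonelli n (F : R -> 'rV[R]_n -> \bar R) :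
  @measurable_family _ (measurableTypeR R) n F -> (forall x v, 0 <= F x v)%E ->
  (\int[mu]_x iint (F x) = iint (fun v => \int[mu]_x F x v))%E.
Proof.
elim: n F => [|n IH] F mF F0 //=.
pose G (p : measurableTypeR R * measurableTypeR R) :=
  iint (fun v : 'rV[R]_n => F p.1 (row_mx p.2%:M v)).
transitivity (\int[mu]_y \int[mu]_x G (x, y))%E.
  apply: (@fubini_tonelli _ _ _ _ R mu mu G).
    have /= := measurable_iint (F := fun (p : measurableTypeR R * measurableTypeR R)
      (v : 'rV[R]_n) => F p.1 (row_mx p.2%:M v)).
    apply => //.
    move=> d' T' k h mk mh; apply: mF.
      exact: (measurableT_comp measurable_fst mk).
    by apply: measurable_row_mx => //; exact: (measurableT_comp measurable_snd mk).
  by move=> p; apply: iint_ge0.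
apply: eq_integral => y _; apply: IH => // d' T' k h mk mh.
by apply: mF => //; apply: measurable_row_mx => //; exact: measurable_cst.
Qed.

Lemma le_iint n (f g : 'rV[R]_n -> \bar R) : measurable_on_rV f ->
  measurable_on_rV g -> (forall x, 0 <= f x)%E ->
  (forall x, f x <= g x)%E -> (iint f <= iint g)%E.
Proof.
elim: n f g => [|n IH] f g mf mg f0 fg /=; first exact: fg.
have g0 x : (0 <= g x)%E by exact: le_trans (f0 x) (fg x).
apply: ge0_le_integral => [//|x _|||x _].
- exact: iint_ge0.
- exact: measurable_iint_cons.
- exact: measurable_iint_cons.
- by apply: IH => //; exact: measurable_on_rV_at.
Qed.

Lemma iintZl n (f : 'rV[R]_n -> \bar R) (k : R) : 0 <= k -> measurable_on_rV f ->
  (forall x, 0 <= f x)%E -> (iint (fun x => k%:E * f x) = k%:E * iint f)%E.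
Proof.
move=> k0; elim: n f => [|n IH] f mf f0 //=.
under eq_integral => x _.
  rewrite IH//; first over.
  exact: measurable_on_rV_at.
rewrite ge0_integralZl_EFin//.
  by move=> x _; exact: iint_ge0.
exact: measurable_iint_cons.
Qed.

Lemma iintD n (f g : 'rV[R]_n -> \bar R) : measurable_on_rV f -> measurable_on_rV g ->
  (forall x, 0 <= f x)%E -> (forall x, 0 <= g x)%E ->
  (iint (fun x => f x + g x) = iint f + iint g)%E.
Proof.
elim: n f g => [|n IH] f g mf mg f0 g0 //=.
under eq_integral => x _.
  rewrite IH//; first over.
    exact: measurable_on_rV_at.
  exact: measurable_on_rV_at.
rewrite ge0_integralD//.
- by move=> x _; exact: iint_ge0.
- exact: measurable_iint_cons.
- by move=> x _; exact: iint_ge0.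
- exact: measurable_iint_cons.
Qed.

End iint.

(** * Linear change of variables *)

Section change_of_variables.
Variable R : realType.
Local Notation mu := (@lebesgue_measure R).

Lemma measurable_on_rV_mulmx n m (f : 'rV[R]_m -> \bar R) (V : 'M[R]_(n, m)) :
  measurable_on_rV f -> measurable_on_rV (fun v => f (v *m V)).
Proof. by move=> mf d T h mh; apply: mf; exact: measurable_row_mul. Qed.

Lemma scalar_mxD n (a b : R) : (a + b)%:M = a%:M + b%:M :> 'M[R]_n.
Proof. exact: raddfD. Qed.

Lemma iint_shift n (f : 'rV[R]_n -> \bar R) b :
  measurable_on_rV f -> (forall x, 0 <= f x)%E ->
  iint (fun v => f (v + b)) = iint f.
Proof.
elim: n f b => [|n IH] f b mf f0 /=; first by rewrite add0r [b]thinmx0.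
rewrite -[b](@hsubmxK R 1 1 n) [lsubmx _]mx11_scalar.
set b0 := lsubmx _ 0 0; set b' := rsubmx _.
under eq_integral => x _.
  under [X in iint X]eq_fun => v.
    rewrite (@add_row_mx R 1 1 n) -scalar_mxD; over.
  rewrite (IH (fun v => f (row_mx (x + b0)%:M v)))//; first over.
  exact: measurable_on_rV_at.
have := @integral_affine R (fun x => iint (fun v : 'rV_n => f (row_mx x%:M v))) 1 b0 (oner_neq0 _).
rewrite normr1 mul1e => <-//.
- by apply: eq_integral => x _; rewrite mul1r.
- exact: measurable_iint_cons.
- by move=> x; exact: iint_ge0.
Qed.

(** Stated as a property of the matrix because it is closed under products; it is then enough to
    treat factors that either act on the first coordinate alone, act on the others alone, or shear
    one into the other. *)
Definition change_of_variables n (V : 'M[R]_n) := forall f,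
  measurable_on_rV f -> (forall x, 0 <= f x)%E ->
  (`|\det V|%:E * iint (fun s => f (s *m V)) = iint f)%E.

Lemma change_of_variables_mul n (A B : 'M[R]_n) :
  change_of_variables A -> change_of_variables B -> change_of_variables (A *m B).
Proof.
move=> cA cB f mf f0; under [X in iint X]eq_fun do rewrite mulmxA.
rewrite det_mulmx normrM mulrC EFinM -muleA (cA (fun s => f (s *m B)))//; first exact: cB.
exact: measurable_on_rV_mulmx.
Qed.

Lemma change_of_variables_tail n (A : 'M[R]_n) :
  change_of_variables A -> @change_of_variables (1 + n) (block_mx 1%:M 0 0 A).
Proof.
move=> cA f mf f0; rewrite det_ublock det1 mul1r /=.
rewrite -ge0_integralZl_EFin//; last 2 first.
- by move=> x _; exact: iint_ge0.
- exact: (measurable_iint_cons (measurable_on_rV_mulmx _ mf)).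
apply: eq_integral => x _; rewrite -(cA (fun v => f (row_mx x%:M v)))//; last first.
  exact: measurable_on_rV_at.
congr (_ * iint _)%E; apply/funext => v.
by rewrite (@mul_row_block R 1 1 n 1 n) !mulmx0 mulmx1 addr0 add0r.
Qed.

Lemma change_of_variables_head n (a : R) : a != 0 ->
  @change_of_variables (1 + n) (block_mx a%:M 0 0 1%:M).
Proof.
move=> a0 f mf f0; rewrite det_ublock det1 mulr1 det_scalar expr1 /=.
rewrite -[RHS](@integral_affine R (fun x => iint (fun v : 'rV_n => f (row_mx x%:M v))) a 0)//; last 2 first.
- exact: measurable_iint_cons.
- by move=> x; exact: iint_ge0.
congr (_ * _)%E; apply: eq_integral => x _; congr iint; apply/funext => v.
by rewrite (@mul_row_block R 1 1 n 1 n) !mulmx0 mulmx1 addr0 add0r -scalar_mxM addr0 mulrC.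
Qed.

Lemma change_of_variables_ushear n (b : 'rV[R]_n) :
  @change_of_variables (1 + n) (block_mx 1%:M b 0 1%:M).
Proof.
move=> f mf f0; rewrite det_ublock !det1 mulr1 normr1 mul1e /=.
apply: eq_integral => x _; rewrite -[RHS](@iint_shift _ _ (x *: b))//; last first.
  exact: measurable_on_rV_at.
congr iint; apply/funext => v.
by rewrite (@mul_row_block R 1 1 n 1 n) !mulmx0 !mulmx1 addr0 mul_scalar_mx addrC.
Qed.

(** The first coordinate is moved by an amount depending on the others, so its integral must become
    the innermost one; after Tonelli the shear is a one-dimensional translation. *)
Lemma change_of_variables_lshear n (c : 'cV[R]_n) :
  @change_of_variables (1 + n) (block_mx 1%:M 0 c 1%:M).
Proof.
move=> f mf f0; rewrite det_lblock !det1 mulr1 normr1 mul1e /=.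
rewrite !iint_tonelli//; last 2 first.
- exact: measurable_on_rV_cons.
- exact: (measurable_on_rV_cons (measurable_on_rV_mulmx _ mf)).
congr iint; apply/funext => v.
rewrite -[RHS](@integral_affine R _ 1 ((v *m c) 0 0))//; last 2 first.
- rewrite normr1 mul1e; apply: eq_integral => x _.
  rewrite (@mul_row_block R 1 1 n 1 n) !mulmx0 !mulmx1 add0r mul1r.
  by rewrite {1}[v *m c]mx11_scalar -scalar_mxD.
- apply: (measurable_on_rV_cons mf) => //; exact: measurable_row_cst.
Qed.

(* Gaussian elimination; if the corner entry vanishes, adding [c^T] times the remaining
   rows, where [c] is the rest of the first column, makes it [|c|^2 > 0]. *)
Lemma iint_mulmx n (V : 'M[R]_n) : V \in unitmx -> change_of_variables V.
Proof.
elim: n V => [|n IH] V uV.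
  by move=> f mf f0; rewrite det_mx00 normr1 mul1e /= mul0mx.
have pivot (W : 'M[R]_(1 + n)) : W \in unitmx -> W 0 0 != 0 -> change_of_variables W.
  move=> uW W00; pose a := W 0 0.
  pose b := ursubmx W; pose c := dlsubmx W; pose D := drsubmx W.
  pose D' := D - a^-1 *: (c *m b).
  have eW : W = block_mx 1%:M 0 (a^-1 *: c) 1%:M *m (block_mx 1%:M 0 0 D' *m
      (block_mx a%:M 0 0 1%:M *m block_mx 1%:M (a^-1 *: b) 0 1%:M)).
    rewrite -[LHS]submxK [ulsubmx W]mx11_scalar.
    have -> : ulsubmx W 0 0 = a by rewrite !mxE; congr (W _ _); apply/val_inj.
    rewrite !mulmx_block !(mul1mx, mulmx1, mul0mx, mulmx0, addr0, add0r).
    rewrite mul_mx_scalar !mul_scalar_mx !scalerA mulfV// !scale1r.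
    by rewrite -scalemxAl addrC subrK.
  move: uW; rewrite eW !unitmx_mul => /andP[_ /andP[uD _]].
  have {}uD : D' \in unitmx by move: uD; rewrite !unitmxE det_ublock det1 mul1r.
  apply: change_of_variables_mul; first exact: change_of_variables_lshear.
  apply: change_of_variables_mul; first by apply: change_of_variables_tail; exact: IH.
  apply: change_of_variables_mul; first exact: change_of_variables_head.
  exact: change_of_variables_ushear.
have [V00|] := eqVneq (V 0 0) 0; last exact: pivot.
pose c : 'cV_n := @dlsubmx R 1 n 1 n V.
have cn0 : c != 0.
  apply/eqP => c0; move: uV; rewrite unitmxE -det_tr.
  rewrite (expand_det_row _ 0) big1 ?unitr0// => j _; rewrite mxE.
  have [k ->|k ->] := @split_ordP 1 n j.
    by rewrite ord1 (_ : lshift n 0 = 0) ?V00 ?mul0r//; exact/val_inj.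
  have /matrixP/(_ k 0) := c0; rewrite !mxE.
  by rewrite (_ : lshift n 0 = 0) => [->|]; [rewrite mul0r|exact/val_inj].
pose U : 'M[R]_(1 + n) := block_mx 1%:M c^T 0 1%:M.
pose U' : 'M[R]_(1 + n) := block_mx 1%:M (- c^T) 0 1%:M.
have UU : U' *m U = 1%:M.
  rewrite mulmx_block !(mul1mx, mulmx1, mul0mx, mulmx0, addr0, add0r) subrr.
  by rewrite -scalar_mx_block.
have -> : V = U' *m (U *m V) by rewrite mulmxA UU mul1mx.
apply: change_of_variables_mul; first exact: change_of_variables_ushear.
apply: pivot.
  by rewrite unitmx_mul uV andbT; case/mulmx1_unit : UU.
rewrite -[V](@submxK R 1 n 1 n) /U (@mulmx_block R 1 n 1 n 1 n) !(mul1mx, mul0mx, add0r).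
have e0 : 0 = lshift n 0 :> 'I_(1 + n) by exact/val_inj.
rewrite [in X in X != _]e0 block_mxEul mxE.
have ul0 : @ulsubmx R 1 n 1 n V 0 0 = 0.
  by rewrite -[RHS]V00 !mxE; congr (V _ _); exact/val_inj.
rewrite ul0 add0r mxE.
rewrite psumr_neq0; last by move=> i _; rewrite mxE -expr2 sqr_ge0.
have /matrix0Pn[i [j cij]] : c != 0 by [].
apply/hasP; exists i; first by rewrite mem_index_enum.
rewrite /= mxE -expr2 lt_neqAle sqr_ge0 eq_sym sqrf_eq0 andbT.
by rewrite ord1 in cij.
Qed.

End change_of_variables.

(** * Homogeneous coordinates *)

Section dotv.
Variables (R : realType) (d : nat).
Implicit Types (u v w : 'rV[R]_d) (a : R).

Lemma dotvE u v : dotv u v = \sum_i u 0 i * v 0 i.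
Proof. by rewrite /dotv mxE; apply: eq_bigr => i _; rewrite mxE. Qed.

Lemma dotvC u v : dotv u v = dotv v u.
Proof. by rewrite !dotvE; apply: eq_bigr => i _; rewrite mulrC. Qed.

Lemma dotvDl u v w : dotv (u + v) w = dotv u w + dotv v w.
Proof. by rewrite /dotv mulmxDl mxE. Qed.

Lemma dotvDr u v w : dotv w (u + v) = dotv w u + dotv w v.
Proof. by rewrite dotvC dotvDl !(dotvC w). Qed.

Lemma dotvZl a u v : dotv (a *: u) v = a * dotv u v.
Proof. by rewrite /dotv -scalemxAl mxE. Qed.

Lemma dotvZr a u v : dotv v (a *: u) = a * dotv v u.
Proof. by rewrite dotvC dotvZl (dotvC v). Qed.

Lemma dotvNl u v : dotv (- u) v = - dotv u v.
Proof. by rewrite -scaleN1r dotvZl mulN1r. Qed.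

Lemma dotvNr u v : dotv v (- u) = - dotv v u.
Proof. by rewrite dotvC dotvNl (dotvC v). Qed.

Lemma dotv0l v : dotv 0 v = 0. Proof. by rewrite /dotv mul0mx mxE. Qed.

Lemma dotv0r v : dotv v 0 = 0. Proof. by rewrite dotvC dotv0l. Qed.

Lemma dotv_suml I (r : seq I) (P : pred I) (F : I -> 'rV[R]_d) v :
  dotv (\sum_(i <- r | P i) F i) v = \sum_(i <- r | P i) dotv (F i) v.
Proof.
exact: (big_morph (fun x => dotv x v) (fun x y => dotvDl x y v) (dotv0l v)).
Qed.

Lemma dotv_sumr I (r : seq I) (P : pred I) (F : I -> 'rV[R]_d) v :
  dotv v (\sum_(i <- r | P i) F i) = \sum_(i <- r | P i) dotv v (F i).
Proof. by rewrite dotvC dotv_suml; apply: eq_bigr => i _; rewrite dotvC. Qed.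

Lemma sqn_ge0 u : 0 <= sqn u.
Proof. by rewrite /sqn dotvE sumr_ge0// => i _; rewrite -expr2 sqr_ge0. Qed.

Lemma sqn_eq0 u : (sqn u == 0) = (u == 0).
Proof.
apply/eqP/eqP => [|->]; last by rewrite /sqn dotv0l.
rewrite /sqn dotvE => /eqP; rewrite psumr_eq0 => [/allP u0|i _]; last first.
  by rewrite -expr2 sqr_ge0.
apply/rowP => i; rewrite mxE; apply/eqP; rewrite -sqrf_eq0 expr2.
by apply: u0; rewrite mem_index_enum.
Qed.

Lemma sqn_gt0 u : (0 < sqn u) = (u != 0).
Proof. by rewrite lt_def sqn_ge0 andbT sqn_eq0. Qed.

Lemma sqnZ a u : sqn (a *: u) = a ^+ 2 * sqn u.
Proof. by rewrite /sqn dotvZl dotvZr mulrA -expr2. Qed.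

Lemma sqnN u : sqn (- u) = sqn u.
Proof. by rewrite /sqn dotvNl dotvNr opprK. Qed.

Lemma sqnD u v : sqn (u + v) = sqn u + dotv u v *+ 2 + sqn v.
Proof. by rewrite /sqn dotvDl !dotvDr (dotvC v u); ring. Qed.

Lemma sqnB u v : sqn (u - v) = sqn u - dotv u v *+ 2 + sqn v.
Proof. by rewrite sqnD sqnN dotvNr mulNrn. Qed.

Lemma dotv_CauchySchwarz u v : dotv u v ^+ 2 <= sqn u * sqn v.
Proof.
have [->|v0] := eqVneq v 0; first by rewrite dotv0r /sqn dotv0r expr0n mulr0.
have v1 : 0 < sqn v by rewrite sqn_gt0.
have := sqn_ge0 (sqn v *: u - dotv u v *: v).
rewrite sqnB !sqnZ dotvZl dotvZr.
have -> : sqn v ^+ 2 * sqn u - (sqn v * (dotv u v * dotv u v)) *+ 2 +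
    dotv u v ^+ 2 * sqn v = sqn v * (sqn u * sqn v - dotv u v ^+ 2) by ring.
by rewrite pmulr_rge0// subr_ge0.
Qed.

(** The difference of the two sides is the weighted variance [sum t_i |F_i - x|^2]. *)
Lemma sqn_convex (I : finType) (t : I -> R) (F : I -> 'rV[R]_d) :
  (forall i, 0 <= t i) -> \sum_i t i = 1 ->
  sqn (\sum_i t i *: F i) <= \sum_i t i * sqn (F i).
Proof.
move=> t0 t1; set x := \sum_i _.
have : 0 <= \sum_i t i * sqn (F i - x).
  by apply: sumr_ge0 => i _; rewrite mulr_ge0// sqn_ge0.
under eq_bigr do rewrite sqnB mulrDr mulrDr.
rewrite 2!big_split /= -mulr_suml t1 mul1r.
have -> : \sum_i t i * - (dotv (F i) x *+ 2) = - (sqn x *+ 2).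
  rewrite {2}/x /sqn dotv_suml -sumrMnl -sumrN; apply: eq_bigr => i _.
  by rewrite dotvZl mulrN mulrnAr.
lra.
Qed.

End dotv.

Section homogeneous.
Variables (R : realType) (d : nat).
Implicit Types (x y : 'rV[R]_d) (s : 'rV[R]_(1 + d)).

Definition hlift x : 'rV[R]_(1 + d) := row_mx 1%:M x.
Definition hd s : R := s 0 (lshift d 0).
Definition tl s : 'rV[R]_d := @rsubmx R 1 1 d s.

Lemma hdD s t : hd (s + t) = hd s + hd t. Proof. by rewrite /hd mxE. Qed.
Lemma hdZ a s : hd (a *: s) = a * hd s. Proof. by rewrite /hd mxE. Qed.
Lemma tlD s t : tl (s + t) = tl s + tl t. Proof. exact: raddfD. Qed.
Lemma tlZ a s : tl (a *: s) = a *: tl s. Proof. exact: linearZ. Qed.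

Lemma hd_row_mx a x : hd (row_mx a%:M x) = a.
Proof. by rewrite /hd row_mxEl mxE eqxx mulr1n. Qed.

Lemma tl_row_mx a x : tl (row_mx a%:M x) = x.
Proof. by rewrite /tl row_mxKr. Qed.

Lemma hd_hlift x : hd (hlift x) = 1. Proof. exact: hd_row_mx. Qed.
Lemma tl_hlift x : tl (hlift x) = x. Proof. exact: tl_row_mx. Qed.

Lemma hd_tl s : s = row_mx (hd s)%:M (tl s).
Proof.
rewrite -{1}[s](@hsubmxK R 1 1 d) [lsubmx s]mx11_scalar; congr row_mx.
by rewrite mxE.
Qed.

Lemma hd_tl_eq s t : hd s = hd t -> tl s = tl t -> s = t.
Proof. by move=> h k; rewrite [s]hd_tl [t]hd_tl h k. Qed.

Definition vmx (v : 'I_d.+1 -> 'rV[R]_d) : 'M[R]_(1 + d) :=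
  \matrix_(i < 1 + d) hlift (v i).

Lemma row_vmx v i : row i (vmx v) = hlift (v i). Proof. exact: rowK. Qed.

Lemma hd_sum I (r : seq I) (P : pred I) (F : I -> 'rV[R]_(1 + d)) :
  hd (\sum_(i <- r | P i) F i) = \sum_(i <- r | P i) hd (F i).
Proof. by rewrite /hd summxE. Qed.

Lemma tl_sum I (r : seq I) (P : pred I) (F : I -> 'rV[R]_(1 + d)) :
  tl (\sum_(i <- r | P i) F i) = \sum_(i <- r | P i) tl (F i).
Proof. exact: raddf_sum. Qed.

Lemma hd_mul_vmx s v : hd (s *m vmx v) = \sum_i s 0 i.
Proof.
rewrite mulmx_sum_row hd_sum; apply: eq_bigr => i _.
by rewrite row_vmx hdZ hd_hlift mulr1.
Qed.

Lemma tl_mul_vmx s v : tl (s *m vmx v) = \sum_i s 0 i *: v i.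
Proof.
rewrite mulmx_sum_row tl_sum; apply: eq_bigr => i _.
by rewrite row_vmx tlZ tl_hlift.
Qed.

Lemma row_mul_vmx v (t : 'I_d.+1 -> R) : \sum_i t i = 1 ->
  (\row_i t i) *m vmx v = hlift (convex_comb v t).
Proof.
move=> t1; apply: hd_tl_eq; rewrite ?hd_hlift ?tl_hlift ?hd_mul_vmx ?tl_mul_vmx.
  by rewrite -t1; apply: eq_bigr => i _; rewrite mxE.
by apply: eq_bigr => i _; rewrite mxE.
Qed.

(** Left multiplication by [L] subtracts the first row from all others and leaves a block triangular
    matrix whose lower block is the matrix [M] of edge vectors. *)
Lemma vmx_unit v :
  (vmx v \in unitmx) = row_free (\matrix_(i < d) (v (lift ord0 i) - v ord0)).
Proof.
set M := \matrix_i _.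
pose L : 'M[R]_(1 + d) := block_mx 1%:M 0 (- const_mx 1) 1%:M.
have -> : (vmx v \in unitmx) = (L *m vmx v \in unitmx).
  by rewrite unitmx_mul [L \in _]unitmxE det_lblock !det1 mulr1 unitr1.
have -> : L *m vmx v = block_mx 1%:M (v ord0) 0 M.
  have -> : vmx v = block_mx 1%:M (v ord0) (const_mx 1) (\matrix_(i < d) v (lift ord0 i)).
    apply/row_matrixP => i; rewrite row_vmx.
    have [j ->|j ->] := @split_ordP 1 d i.
      rewrite rowKu row_row_mx !row_id /hlift; congr (row_mx _ (v _)).
      by apply/val_inj; rewrite ord1.
    rewrite rowKd row_row_mx rowK /hlift; congr (row_mx _ (v _)); last exact/val_inj.
    by apply/rowP => k; rewrite !mxE ord1 eqxx.
  rewrite mulmx_block !(mul1mx, mul0mx, addr0); congr block_mx.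
    by rewrite mulmx1 addNr.
  apply/row_matrixP => i; rewrite rowK linearD /= row_mul rowK addrC.
  congr (_ + _); apply/rowP => k; rewrite !mxE big_ord1 !mxE mulN1r //.
by rewrite unitmxE det_ublock det1 mul1r -unitmxE row_free_unit.
Qed.

End homogeneous.

(** * Volume as an integral over the cone spanned by the simplex *)

Section cone.
Variable R : realType.
Local Notation mu := (@lebesgue_measure R).

Definition curv (g : geometry) : R := match g with Euclidean => 0 | Hyperbolic => 1 end.

Definition qform g d (y : 'rV[R]_(1 + d)) : R := hd y ^+ 2 - curv g * sqn (tl y).

Definition hinge (t : R) : R := Num.max 0 (1 - t).

(* Discarding [s = 0] makes [s *m vmx v] range over points with positive first coordinate. *)
Definition orthant n (s : 'rV[R]_n) : R :=
  (\prod_i (0 <= s 0 i)%R%:R) * (0 < \sum_i s 0 i)%R%:R.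

Definition orthant_integral n (Q : 'rV[R]_n -> R) : \bar R :=
  iint (fun s => (orthant s * hinge (Q s))%:E).

Lemma orthantP n (s : 'rV[R]_n) :
  orthant s = ([forall i, 0 <= s 0 i] && (0 < \sum_i s 0 i))%R%:R.
Proof.
rewrite /orthant; case: forallP => [s0|ns] /=.
  by rewrite big1 ?mul1r// => i _; rewrite s0.
suff -> : \prod_i (0 <= s 0 i)%R%:R = 0 :> R by rewrite mul0r.
have /existsP[i si] : [exists i, ~~ (0 <= s 0 i)].
  by rewrite -negb_forall; apply/forallP.
by rewrite (bigD1 i)//= (negbTE si) mul0r.
Qed.

Lemma orthant_ge0 n (s : 'rV[R]_n) : 0 <= orthant s.
Proof. by rewrite orthantP ler0n. Qed.

Lemma hinge_ge0 t : 0 <= hinge t.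
Proof. by rewrite /hinge le_max lexx. Qed.

Lemma hinge_le1 t : 0 <= t -> hinge t <= 1.
Proof. by move=> t0; rewrite /hinge ge_max ler01 gerBl. Qed.

Lemma orthant_hinge_ge0 n (Q : 'rV[R]_n -> R) s :
  (0 <= (orthant s * hinge (Q s))%:E)%E.
Proof. by rewrite lee_fin mulr_ge0 ?orthant_ge0 ?hinge_ge0. Qed.

Lemma measurable_ge0 d (T : measurableType d) (f : T -> R) :
  measurable_fun setT f -> measurable_fun setT (fun t => (0 <= f t)%R%:R : R).
Proof.
move=> mf; apply: (@measurableT_comp _ _ _ _ _ _ (fun x : R => (0 <= x)%R%:R : R)) => //.
have -> : (fun x : R => (0 <= x)%R%:R : R) = \1_(`[0%R, +oo[%classic : set R).
  by apply/funext => x; rewrite indicE mem_setE in_itv /= andbT.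
exact: measurable_indic.
Qed.

Lemma measurable_gt0 d (T : measurableType d) (f : T -> R) :
  measurable_fun setT f -> measurable_fun setT (fun t => (0 < f t)%R%:R : R).
Proof.
move=> mf; apply: (@measurableT_comp _ _ _ _ _ _ (fun x : R => (0 < x)%R%:R : R)) => //.
have -> : (fun x : R => (0 < x)%R%:R : R) = \1_(`]0%R, +oo[%classic : set R).
  by apply/funext => x; rewrite indicE mem_setE in_itv /= andbT.
exact: measurable_indic.
Qed.

Lemma measurable_hinge d (T : measurableType d) (f : T -> R) :
  measurable_fun setT f -> measurable_fun setT (fun t => hinge (f t)).
Proof.
move=> mf; apply: measurable_maxr; first exact: measurable_cst.
by apply: measurable_funB => //; exact: measurable_cst.
Qed.

Lemma measurable_orthant d (T : measurableType d) n (h : T -> 'rV[R]_n) :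
  measurable_row h -> measurable_fun setT (fun t => orthant (h t)).
Proof.
move=> mh; apply: measurable_funM.
  by apply: measurable_prod => i _; apply: measurable_ge0; exact: mh.
by apply: measurable_gt0; apply: measurable_sum => i; exact: mh.
Qed.

Definition measurable_real_on_rV n (f : 'rV[R]_n -> R) :=
  forall d (T : measurableType d) (h : T -> 'rV[R]_n),
    measurable_row h -> measurable_fun setT (fun t => f (h t)).

Lemma measurable_sqn d (T : measurableType d) n (h : T -> 'rV[R]_n) :
  measurable_row h -> measurable_fun setT (fun t => sqn (h t)).
Proof.
move=> mh; under eq_fun do rewrite /sqn dotvE.
by apply: measurable_sum => i; apply: measurable_funM; exact: mh.
Qed.

Lemma measurable_qform g d : measurable_real_on_rV (@qform g d).
Proof.
move=> d' T h mh; apply: measurable_funB.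
  by apply: measurable_funX; exact: mh.
apply: measurable_funM; first exact: measurable_cst.
by apply: measurable_sqn; exact: measurable_row_tail.
Qed.

Lemma measurable_orthant_hinge n (Q : 'rV[R]_n -> R) :
  measurable_real_on_rV Q ->
  measurable_on_rV (fun s => (orthant s * hinge (Q s))%:E).
Proof.
move=> mQ d T h mh; apply/measurable_EFinP; apply: measurable_funM.
  exact: measurable_orthant.
by apply: measurable_hinge; exact: mQ.
Qed.

Lemma orthantZ n (a : R) (s : 'rV[R]_n) : 0 < a -> orthant (a *: s) = orthant s.
Proof.
move=> a0; rewrite /orthant; congr (_ * _).
  by apply: eq_bigr => i _; rewrite mxE pmulr_rge0.
congr ((_ : bool)%:R); under eq_bigr do rewrite mxE.
by rewrite -mulr_sumr pmulr_rgt0.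
Qed.

Lemma orthant_diag n (a s : 'rV[R]_n) : (forall i, 0 < a 0 i) ->
  orthant (s *m diag_mx a) = orthant s.
Proof.
move=> a0; rewrite !orthantP; congr ((_ : bool)%:R).
have e i : (s *m diag_mx a) 0 i = s 0 i * a 0 i by rewrite mul_mx_diag mxE.
have -> : [forall i, 0 <= (s *m diag_mx a) 0 i] = [forall i, 0 <= s 0 i].
  by apply: eq_forallb => i; rewrite e pmulr_lge0.
case: forallP => //= s0.
rewrite !lt_def !sumr_ge0// ?andbT; last by move=> i _; rewrite e pmulr_lge0.
congr (~~ _); rewrite !psumr_eq0//; last by move=> i _; rewrite e pmulr_lge0.
by apply: eq_all => i /=; rewrite e mulf_eq0 [a 0 i == 0]gt_eqF ?orbF.
Qed.

Lemma orthant_perm n (p : 'S_n) (s : 'rV[R]_n) : orthant (s *m perm_mx p) = orthant s.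
Proof.
have e i : (s *m perm_mx p) 0 i = s 0 ((p^-1)%g i).
  by rewrite -[p in perm_mx p]invgK -col_permE mxE.
rewrite /orthant; congr (_ * _).
  rewrite (reindex_inj (@perm_inj _ p)) /=.
  by apply: eq_bigr => i _; rewrite e permK.
congr ((_ : bool)%:R); rewrite (reindex_inj (@perm_inj _ p)) /=.
by congr (0 < _); apply: eq_bigr => i _; rewrite e permK.
Qed.

End cone.

Section cone_volume.
Variable R : realType.
Local Notation mu := (@lebesgue_measure R).

(** The contribution of the ray through [(1, x)] to the cone integral, with [m = 1 - k |x|^2]: the
    factor [u ^+ d] is the Jacobian of [(u, x) |-> (u, u x)]. *)
Definition radial d (m : R) : \bar R :=
  (\int[mu]_u ((0 < u)%R%:R * u ^+ d * hinge (u ^+ 2 * m))%:E)%E.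

Lemma measurable_radial d m :
  measurable_fun [set: R] (fun u : R => ((0 < u)%R%:R * u ^+ d * hinge (u ^+ 2 * m))%:E).
Proof.
apply/measurable_EFinP; apply: measurable_funM.
  by apply: measurable_funM; [exact: measurable_gt0|exact: measurable_funX].
by apply: measurable_hinge; apply: measurable_funM => //; exact: measurable_funX.
Qed.

Lemma radial_integrand_ge0 d m (u : R) :
  (0 <= ((0 < u)%R%:R * u ^+ d * hinge (u ^+ 2 * m))%:E)%E.
Proof.
rewrite lee_fin; apply: mulr_ge0; last exact: hinge_ge0.
by case: ltP => [u0|_]; rewrite ?mul0r// mul1r exprn_ge0// ltW.
Qed.

(** Only positivity and finiteness matter, since the constant is common to both sides of every
    comparison of volumes. Indicators of intervals bound the integrand from both sides. *)
Lemma radial1 d : exists2 C : R, 0 < C & radial d 1 = C%:E.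
Proof.
have le1 : (radial d 1 <= 1)%E.
  apply: (@le_trans _ _ (\int[mu]_x (\1_(`[0, 1]%classic : set R) x)%:E)%E); last first.
    rewrite integral_indic// setIT /= lebesgue_measure_itv /= lte_fin ltr01.
    by rewrite sube0.
  apply: ge0_le_integral => //.
  - by move=> x _; exact: radial_integrand_ge0.
  - exact: measurable_radial.
  - by apply/measurable_EFinP; exact: measurable_indic.
  move=> x _; rewrite lee_fin indicE mem_setE in_itv /= mulr1.
  case: ltP => [x0|_]; last by rewrite !mul0r ler0n.
  rewrite (ltW x0) mul1r /=; case: (leP x 1) => x1 /=.
    by rewrite mulr_ile1 ?hinge_ge0 ?exprn_ge0 ?(ltW x0) ?exprn_ile1 ?hinge_le1 ?exprn_ge0 ?(ltW x0).  
  by rewrite /hinge max_l ?mulr0// subr_le0 exprn_ege1// ltW.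
have gt0 : (0 < radial d 1)%E.
  (* On [[1/2, 3/4]] one has [u ^ d >= 2 ^ (-d)] and [1 - u^2 >= 7/16 >= 1/4]. *)
  pose c : R := 2^-1 ^+ d / 4.
  have c0 : 0 < c by rewrite divr_gt0// exprn_gt0// invr_gt0.
  apply: (@lt_le_trans _ _ (\int[mu]_x (c%:E * (\1_(`[2^-1, 3 / 4]%classic : set R) x)%:E))%E).
    rewrite ge0_integralZl_EFin//; last 2 first.
    - by apply/measurable_EFinP; exact: measurable_indic.
    - exact: ltW.
    rewrite integral_indic// setIT /= lebesgue_measure_itv /= lte_fin.
    rewrite ifT; last by lra.
    by rewrite -EFinB -EFinM lte_fin mulr_gt0//; lra.
  apply: ge0_le_integral => //.
  - by move=> x _; rewrite lee_fin mulr_ge0 ?(ltW c0).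
  - by apply/measurable_EFinP; apply: measurable_funM => //; exact: measurable_indic.
  - exact: measurable_radial.
  move=> x _; rewrite indicE mem_setE in_itv /=.
  case: andP => [[x1 x2]|_]; last by rewrite mule0 radial_integrand_ge0.
  have x0 : 0 < x by lra.
  rewrite -EFinM lee_fin x0 mul1r !mulr1 /c; apply: ler_pM.
  - by rewrite exprn_ge0// invr_ge0.
  - by rewrite invr_ge0.
  - by rewrite lerXn2r// nnegrE ?invr_ge0// ltW.
  - by rewrite /hinge le_max; apply/orP; right; nra.
move: gt0 le1; case: (radial d 1) => [r| |] //.
by rewrite lte_fin => r0 _; exists r.
Qed.

(** The substitution of [u / sqrt m] for [u] produces exactly the exponent of [density]; this is
    what makes hyperbolic volume a cone integral. *)
Lemma radialE d m C : 0 < m -> radial d 1 = C%:E ->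
  radial d m = (powR m (- (d.+1%:R / 2)) * C)%:E.
Proof.
move=> m0 rC; pose a := Num.sqrt m.
have a0 : 0 < a by rewrite sqrtr_gt0.
have am : a ^+ 2 = m by rewrite sqr_sqrtr// ltW.
have : (`|a|%:E * ((a ^+ d)%:E * radial d m))%E = C%:E.
  rewrite -rC -[RHS](@integral_affine R _ a 0)//; last 3 first.
  - by rewrite gt_eqF.
  - exact: measurable_radial.
  - exact: radial_integrand_ge0.
  congr (_ * _)%E; rewrite -ge0_integralZl_EFin//; last 3 first.
  - by move=> x _; exact: radial_integrand_ge0.
  - exact: measurable_radial.
  - by rewrite exprn_ge0// ltW.
  apply: eq_integral => x _; rewrite -EFinM; congr (_%:E).
  rewrite addr0 pmulr_rgt0// !exprMn am mulr1 [m * _]mulrC; ring.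
rewrite gtr0_norm// muleA -EFinM -exprS => e.
have p0 : 0 < powR m (d.+1%:R / 2) by exact: powR_gt0.
have ap : a ^+ d.+1 = powR m (d.+1%:R / 2).
  by rewrite -powR_mulrn ?ltW// /a -powR12_sqrt ?ltW// -powRrM mulrC.
have e' : ((powR m (- (d.+1%:R / 2)))%:E * ((a ^+ d.+1)%:E * radial d m) = radial d m)%E.
  by rewrite muleA -EFinM powRN ap mulVf ?mul1e// gt_eqF.
by rewrite -e' e EFinM.
Qed.

Lemma densityE g d (x : 'rV[R]_d) :
  density g x = powR (1 - curv R g * sqn x) (- (d.+1%:R / 2)).
Proof. by case: g => /=; rewrite ?mul0r ?subr0 ?powR1 ?mul1r. Qed.

Lemma in_space_curv g d (x : 'rV[R]_d) : in_space g x <-> 0 < 1 - curv R g * sqn x.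
Proof.
case: g => /=; first by rewrite mul0r subr0 ltr01.
by rewrite mul1r subr_gt0.
Qed.

Lemma convex_sum_gt0 (I : finType) (t a : I -> R) : (forall i, 0 <= t i) ->
  \sum_i t i = 1 -> (forall i, 0 < a i) -> 0 < \sum_i t i * a i.
Proof.
move=> t0 t1 a0; have ta i : 0 <= t i * a i by rewrite mulr_ge0// ltW.
rewrite lt_def sumr_ge0// andbT psumr_eq0//; apply/negP => /allP h.
have /eqP := oner_neq0 R; apply; rewrite -t1 big1// => i _; apply/eqP.
by have := h i (mem_index_enum i); rewrite /= mulf_eq0 (gt_eqF (a0 i)) orbF.
Qed.

Lemma simplex_in_space g d (v : 'I_d.+1 -> 'rV[R]_d) x :
  (forall i, in_space g (v i)) -> simplex_set v x -> in_space g x.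
Proof.
case: g => //= v1 [t [[t0 t1] ->]].
apply: (le_lt_trans (sqn_convex _ t0 t1)).
rewrite -subr_gt0 -t1 -sumrB.
under eq_bigr do rewrite -[X in X - _]mulr1 -mulrBr.
by apply: convex_sum_gt0 => // i; rewrite subr_gt0.
Qed.

Lemma simplex_setE d (v : 'I_d.+1 -> 'rV[R]_d) x : vmx v \in unitmx ->
  (x \in simplex_set v) = [forall i, 0 <= (hlift x *m invmx (vmx v)) 0 i].
Proof.
move=> uv; apply/idP/forallP => [/set_mem[t [[t0 t1] ->]] i|h].
  by rewrite -row_mul_vmx// mulmxK// mxE.
apply/mem_set; exists (fun i => (hlift x *m invmx (vmx v)) 0 i).
have e : (hlift x *m invmx (vmx v)) *m vmx v = hlift x by rewrite mulmxKV.
split; first split => //.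
  by rewrite -(hd_mul_vmx _ v) e hd_hlift.
by rewrite /convex_comb -tl_mul_vmx e tl_hlift.
Qed.

Lemma indic_simplex d (v : 'I_d.+1 -> 'rV[R]_d) x : vmx v \in unitmx ->
  \1_(simplex_set v) x = orthant (hlift x *m invmx (vmx v)).
Proof.
move=> uv; rewrite indicE simplex_setE// orthantP.
suff -> : \sum_i (hlift x *m invmx (vmx v)) 0 i = 1 by rewrite ltr01 andbT.
by rewrite -(hd_mul_vmx _ v) mulmxKV// hd_hlift.
Qed.

Lemma measurable_hlift d' (T : measurableType d') d (h : T -> 'rV[R]_d) :
  measurable_row h -> measurable_row (fun t => hlift (h t)).
Proof. by move=> mh; apply: measurable_row_mx => //; exact: measurable_cst. Qed.

Lemma measurable_indic_simplex d' (T : measurableType d') d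
    (v : 'I_d.+1 -> 'rV[R]_d) (h : T -> 'rV[R]_d) : vmx v \in unitmx ->
  measurable_row h -> measurable_fun setT (fun t => \1_(simplex_set v) (h t) : R).
Proof.
move=> uv mh; under eq_fun do rewrite indic_simplex//.
by apply: measurable_orthant; apply: measurable_row_mul; exact: measurable_hlift.
Qed.

Lemma hd_mul_invmx d (v : 'I_d.+1 -> 'rV[R]_d) (y : 'rV[R]_(1 + d)) :
  vmx v \in unitmx -> \sum_i (y *m invmx (vmx v)) 0 i = hd y.
Proof. by move=> uv; rewrite -(hd_mul_vmx _ v) mulmxKV. Qed.

(** The function [F] is integrated in two ways: in the coordinates [s] of the cone, which gives the
    right-hand side, and in the coordinates [(u, x) |-> (u, u x)], where the integral over [u] is
    [radial] and turns into the density. *)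
Lemma cone_volume g d (v : 'I_d.+1 -> 'rV[R]_d) C : radial d 1 = C%:E ->
  is_simplex g v ->
  (C%:E * gvol g (simplex_set v) =
   `|\det (vmx v)|%:E * orthant_integral (fun s => qform g (s *m vmx v)))%E.
Proof.
move=> rC [vs vf]; have uv : vmx v \in unitmx by rewrite vmx_unit.
pose F (y : 'rV[R]_(1 + d)) := (orthant (y *m invmx (vmx v)) * hinge (qform g y))%:E.
have mF : measurable_on_rV F.
  move=> d' T h mh; apply/measurable_EFinP; apply: measurable_funM.
    by apply: measurable_orthant; exact: measurable_row_mul.
  by apply: measurable_hinge; exact: measurable_qform.
have F0 y : (0 <= F y)%E by rewrite lee_fin mulr_ge0 ?orthant_ge0 ?hinge_ge0.
transitivity (iint F); last first.
  rewrite -(iint_mulmx uv mF F0); congr (_ * iint _)%E; apply/funext => s.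
  by rewrite /F mulmxK.
pose m (x : 'rV[R]_d) := 1 - curv R g * sqn x.
pose G (u : R) (x : 'rV[R]_d) := (\1_(simplex_set v) x *
  ((0 < u)%R%:R * u ^+ d * hinge (u ^+ 2 * m x)))%:E.
have G0 u x : (0 <= G u x)%E.
  have := radial_integrand_ge0 d (m x) u; rewrite !lee_fin => h.
  by rewrite mulr_ge0// indicE ler0n.
have mG : @measurable_family R _ (measurableTypeR R) d G.
  move=> d' T k h mk mh; apply/measurable_EFinP; apply: measurable_funM.
    exact: measurable_indic_simplex.
  apply: measurable_funM.
    by apply: measurable_funM; [exact: measurable_gt0|exact: measurable_funX].
  apply: measurable_hinge; apply: measurable_funM; first exact: measurable_funX.
  apply: measurable_funB; first exact: measurable_cst.
  by apply: measurable_funM; [exact: measurable_cst|exact: measurable_sqn].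
transitivity (\int[mu]_u iint (G u))%E; last first.
  (* At height [u <= 0] both sides vanish, [F] because the cone coordinates of a point sum to its
     height; the strict inequality in [orthant] takes care of [u = 0]. For [0 < u] the slice is
     rescaled to height 1. *)
  apply: eq_integral => u _; have [u0|u0] := ltP 0 u; last first.
    congr iint; apply/funext => x; rewrite /G /F ltNge u0 !mul0r mulr0 orthantP.
    by rewrite hd_mul_invmx// hd_row_mx ltNge u0 andbF mul0r.
  have uu : (u%:M : 'M[R]_d) \in unitmx by rewrite unitmxE det_scalar unitfE expf_neq0// gt_eqF.
  rewrite -[RHS](iint_mulmx uu (f := fun x => F (row_mx u%:M x)))//; last exact: measurable_on_rV_at.
  rewrite det_scalar ger0_norm ?exprn_ge0 ?ltW// -iintZl ?exprn_ge0 ?ltW//; last first.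
    exact: (measurable_on_rV_mulmx _ (measurable_on_rV_at _ mF)).
  congr iint; apply/funext => x; rewrite -EFinM; congr (_%:E).
  rewrite u0 mul_mx_scalar.
  have -> : row_mx u%:M (u *: x) = u *: hlift x.
    by rewrite /hlift scale_row_mx scalemx1.
  rewrite -scalemxAl orthantZ// -indic_simplex// mul1r mulrCA; congr (_ * (_ * hinge _)).
  by rewrite /qform hdZ tlZ hd_hlift tl_hlift sqnZ /m; ring.
have C0 : 0 <= C.
  by rewrite -lee_fin -rC; apply: integral_ge0 => u _; exact: radial_integrand_ge0.
rewrite iint_tonelli// /gvol -iintZl//; last first.
- by move=> x; rewrite lee_fin mulr_ge0 ?indicE// densityE powR_ge0.
- move=> d' T h mh; apply/measurable_EFinP; apply: measurable_funM.
    exact: measurable_indic_simplex.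
  under eq_fun do rewrite densityE.
  apply: (@measurableT_comp _ _ _ _ _ _ (fun x => powR x _)) => //.
  apply: measurable_funB; first exact: measurable_cst.
  by apply: measurable_funM; [exact: measurable_cst|exact: measurable_sqn].
congr iint; apply/funext => x; rewrite /G indicE.
have [xv|xv] := boolP (x \in simplex_set v); last first.
  by rewrite mul0r mule0 integral0_eq// => u _; rewrite mul0r.
under eq_integral do rewrite mul1r.
rewrite -/(radial d (m x)) mul1r densityE (@radialE _ _ C)// -?EFinM 1?mulrC//.
by apply/in_space_curv; apply: simplex_in_space (set_mem xv).
Qed.

End cone_volume.

(** * Isometries *)

Section isometry.
Variables (R : realType) (g : geometry) (d : nat).
Implicit Types (x y : 'rV[R]_d) (v : 'I_d.+1 -> 'rV[R]_d).

(** [T] is the projective map induced by the linear map [L]; the factor [a] appears because [L] need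
    not preserve height 1. Invariance of volume can then be derived from [L] through the cone
    formula, without a nonlinear change of variables in the model. *)
Definition isometry_by (L : 'M[R]_(1 + d)) (T : 'rV[R]_d -> 'rV[R]_d) : Prop :=
  [/\ L \in unitmx, `|\det L| = 1,
      forall s : 'rV[R]_(1 + d), qform g (s *m L) = qform g s,
      forall x, in_space g x -> exists2 a, 0 < a & hlift x *m L = a *: hlift (T x) &
      forall x y, in_space g x -> in_space g y -> gdist g (T x) (T y) = gdist g x y].

Lemma qform_hlift x : qform g (hlift x) = 1 - curv R g * sqn x.
Proof. by rewrite /qform hd_hlift tl_hlift expr1n. Qed.

Lemma qformZ a (y : 'rV[R]_(1 + d)) : qform g (a *: y) = a ^+ 2 * qform g y.
Proof. by rewrite /qform hdZ tlZ sqnZ; ring. Qed.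

(** Positive diagonal matrices preserve the orthant. This absorbs the factors by which the rows of
    [vmx v *m L] differ from lifts of points. *)
Lemma orthant_integral_diag (a : 'rV[R]_(1 + d)) (Q : 'rV[R]_(1 + d) -> R) :
  measurable_real_on_rV Q -> (forall i, 0 < a 0 i) ->
  (`|\det (diag_mx a)|%:E * orthant_integral (fun s => Q (s *m diag_mx a)) =
   orthant_integral Q)%E.
Proof.
move=> mQ a0.
have ua : diag_mx a \in unitmx.
  by rewrite unitmxE det_diag unitfE; apply/prodf_neq0 => i _; rewrite gt_eqF.
rewrite /orthant_integral -(iint_mulmx ua (measurable_orthant_hinge mQ)); last first.
  exact: orthant_hinge_ge0.
by congr (_ * iint _)%E; apply/funext => s; rewrite orthant_diag.
Qed.

Section theory.
Variables (L : 'M[R]_(1 + d)) (T : 'rV[R]_d -> 'rV[R]_d).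
Hypothesis isoT : isometry_by L T.

Lemma isometry_in_space x : in_space g x -> in_space g (T x).
Proof.
case: isoT => _ _ qL TL _ xs; have [a a0 e] := TL _ xs.
move/in_space_curv: xs; rewrite -qform_hlift -qL e qformZ qform_hlift.
by rewrite pmulr_rgt0 ?exprn_gt0// => /in_space_curv.
Qed.

Lemma isometry_vmx v : (forall i, in_space g (v i)) ->
  exists2 a : 'rV[R]_(1 + d), forall i, 0 < a 0 i &
    vmx v *m L = diag_mx a *m vmx (T \o v).
Proof.
case: isoT => _ _ _ TL _ vs.
have ex i : exists a, 0 < a /\ hlift (v i) *m L = a *: hlift (T (v i)).
  by have [a a0 e] := TL _ (vs i); exists a.
exists (\row_i (projT1 (cid (ex i)))) => [i|].
  by rewrite mxE; case: (cid _) => a [].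
apply/row_matrixP => i; rewrite !row_mul row_vmx row_diag_mx -scalemxAl -rowE row_vmx mxE.
by case: (cid _) => a [] /=.
Qed.

Lemma isometry_simplex v : is_simplex g v -> is_simplex g (T \o v).
Proof.
move=> [vs vf]; split => [i|]; first exact: isometry_in_space.
rewrite -(vmx_unit (T \o v)); have [a a0 e] := isometry_vmx vs.
have : vmx v *m L \in unitmx.
  by rewrite unitmx_mul vmx_unit vf; case: isoT.
by rewrite e unitmx_mul => /andP[].
Qed.

Lemma isometry_volume v : is_simplex g v ->
  gvol g (simplex_set (T \o v)) = gvol g (simplex_set v).
Proof.
move=> sv; have [C C0 rC] := radial1 R d.
have sTv := isometry_simplex sv; have [a a0 e] := isometry_vmx sv.1.
have [uL dL qL _ _] := isoT.
suff : (C%:E * gvol g (simplex_set (T \o v)) = C%:E * gvol g (simplex_set v))%E.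
  move/(congr1 (mule (C^-1)%:E)).
  by rewrite !muleA -!EFinM mulVf ?gt_eqF// !mul1e.
rewrite (cone_volume rC sTv) (cone_volume rC sv).
have -> : orthant_integral (fun s => qform g (s *m vmx v)) =
    orthant_integral (fun s => qform g (s *m diag_mx a *m vmx (T \o v))).
  by congr orthant_integral; apply/funext => s; rewrite -qL -mulmxA e mulmxA.
have -> : `|\det (vmx v)| = `|\det (vmx (T \o v))| * `|\det (diag_mx a)|.
  by rewrite -[LHS]mulr1 -dL -normrM -det_mulmx e det_mulmx normrM mulrC.
rewrite EFinM -muleA (orthant_integral_diag (Q := fun s => qform g (s *m vmx (T \o v))))//.
by move=> d' T' h mh; apply: measurable_qform; exact: measurable_row_mul.
Qed.

(** A projective map multiplies the weights by positive factors and renormalises them. Zero weights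
    stay zero, so facets are sent into facets. *)
Lemma isometry_convex_comb v t : (forall i, in_space g (v i)) -> is_weights t ->
  exists u, [/\ is_weights u, forall j, t j = 0 -> u j = 0 &
    T (convex_comb v t) = convex_comb (T \o v) u].
Proof.
move=> vs [t0 t1]; have [a a0 e] := isometry_vmx vs.
have xs : in_space g (convex_comb v t).
  by apply: (@simplex_in_space R g d v) => //; exists t.
have [_ _ _ TL _] := isoT; have [b b0 eb] := TL _ xs.
pose u : 'rV[R]_(1 + d) := b^-1 *: ((\row_i t i) *m diag_mx a).
have uE i : u 0 i = b^-1 * (t i * a 0 i) by rewrite mxE mul_mx_diag !mxE.
have hu : hlift (T (convex_comb v t)) = u *m vmx (T \o v).
  rewrite /u -scalemxAl -mulmxA -e mulmxA.
  by rewrite row_mul_vmx// eb scalerA mulVf ?gt_eqF// scale1r.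
exists (fun i => u 0 i); split.
- split=> [i|]; first by rewrite uE mulr_ge0 ?invr_ge0 ?(ltW b0)// mulr_ge0// ltW.
  by rewrite -(hd_mul_vmx _ (T \o v)) -hu hd_hlift.
- by move=> j tj; rewrite uE tj mul0r mulr0.
- by rewrite -[LHS]tl_hlift hu tl_mul_vmx.
Qed.

Lemma isometry_simplex_set v x : (forall i, in_space g (v i)) ->
  simplex_set v x -> simplex_set (T \o v) (T x).
Proof.
move=> vs [t [wt ->]]; have [u [wu _ e]] := isometry_convex_comb vs wt.
by exists u.
Qed.

Lemma isometry_facet v j x : (forall i, in_space g (v i)) ->
  facet v j x -> facet (T \o v) j (T x).
Proof.
move=> vs [t [wt [tj ->]]]; have [u [wu u0 e]] := isometry_convex_comb vs wt.
by exists u; split=> //; split=> //; exact: u0.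
Qed.

Lemma isometry_ball c r x : in_space g c -> gball g c r x -> gball g (T c) r (T x).
Proof.
case: isoT => _ _ _ _ dT cs [xs xr]; split; first exact: isometry_in_space.
by rewrite dT.
Qed.

Lemma isometry_regular v : (forall i, in_space g (v i)) -> regular g v ->
  regular g (T \o v).
Proof.
by case: isoT => _ _ _ _ dT vs rv i j k l ij kl; rewrite /= !dT//; exact: rv.
Qed.

End theory.
End isometry.

(** * Averaging over the permutations of the vertices *)

Section permutation_moments.
Variables (R : realType) (d : nat).
Local Notation N := (#|{: 'S_d.+1}|%:R : R).
Local Notation n := (d.+1%:R : R).

(** Composing with a transposition shows that the sum on the left does not depend on [i]; summed
    over all [i], each permutation contributes every [f k] once. *)
Lemma perm_moment1 (f : 'I_d.+1 -> R) i :
  n * \sum_(p : 'S_d.+1) f (p i) = N * \sum_k f k.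
Proof.
have c j : \sum_(p : 'S_d.+1) f (p j) = \sum_(p : 'S_d.+1) f (p i).
  rewrite (reindex_inj (mulgI (tperm i j))) /=.
  by apply: eq_bigr => p _; rewrite permM tpermR.
transitivity (\sum_j \sum_(p : 'S_d.+1) f (p j)).
  by under [RHS]eq_bigr do rewrite c; rewrite sumr_const card_ord mulr_natl.
rewrite exchange_big /=.
under eq_bigr => p _.
  rewrite -(reindex_inj (@perm_inj _ p) (P := predT) (F := f)); over.
by rewrite sumr_const mulr_natl cardT.
Qed.

(** By symmetry all [j] other than [i] give the same sum; adding these up turns [s (p j)] into the
    total minus [s (p i)], which leaves a moment in the single index [i]. *)
Lemma perm_moment2 (s : 'I_d.+1 -> R) i j : j != i ->
  n * d%:R * \sum_(p : 'S_d.+1) s (p i) * s (p j) =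
  N * ((\sum_k s k) ^+ 2 - \sum_k s k ^+ 2).
Proof.
move=> ji.
have c k : k != i -> \sum_(p : 'S_d.+1) s (p i) * s (p k) =
                     \sum_(p : 'S_d.+1) s (p i) * s (p j).
  move=> ki; rewrite (reindex_inj (mulgI (tperm j k))) /=.
  by apply: eq_bigr => p _; rewrite !permM tpermR tpermD// eq_sym.
have -> : n * d%:R * \sum_(p : 'S_d.+1) s (p i) * s (p j) =
    n * \sum_(p : 'S_d.+1) \sum_(k | k != i) s (p i) * s (p k).
  rewrite -mulrA; congr (_ * _); rewrite exchange_big /=.
  under [RHS]eq_bigr => k ki do rewrite c//.
  by rewrite sumr_const cardC1 card_ord mulr_natl.
have e (p : 'S_d.+1) : \sum_(k | k != i) s (p i) * s (p k) =
    (fun k => s k * (\sum_l s l) - s k ^+ 2) (p i).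
  rewrite -mulr_sumr (reindex_inj (@perm_inj _ p) (P := predT) (F := s)) /=.
  by rewrite [in RHS](bigD1 i)//=; ring.
under eq_bigr do rewrite e.
rewrite (perm_moment1 (fun k => s k * (\sum_l s l) - s k ^+ 2)).
by rewrite sumrB -mulr_suml expr2.
Qed.

(** Averaging weights all diagonal entries of [G] alike and all off-diagonal entries alike, so only
    the trace and the total sum survive. *)
Lemma perm_quadratic (s : 'I_d.+1 -> R) (G : 'I_d.+1 -> 'I_d.+1 -> R) :
  n * d%:R * \sum_(p : 'S_d.+1) \sum_i \sum_j s (p i) * s (p j) * G i j =
  N * (d%:R * (\sum_k s k ^+ 2) * (\sum_i G i i) +
       ((\sum_k s k) ^+ 2 - \sum_k s k ^+ 2) * (\sum_i \sum_j G i j - \sum_i G i i)).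
Proof.
set S2 := \sum_k s k ^+ 2; set P := (\sum_k s k) ^+ 2.
have e i : n * d%:R * \sum_(p : 'S_d.+1) \sum_j s (p i) * s (p j) * G i j =
    N * d%:R * S2 * G i i + N * (P - S2) * (\sum_j G i j - G i i).
  rewrite exchange_big /= mulr_sumr (bigD1 i)//=; congr (_ + _).
    rewrite -mulr_suml; under eq_bigr do rewrite -expr2.
    have := perm_moment1 (fun k => s k ^+ 2) i => /= h.
    have -> : N * d%:R * S2 * G i i = d%:R * (N * S2) * G i i by ring.
    by rewrite -h; ring.
  rewrite [in RHS](bigD1 i)//=.
  rewrite (_ : _ + _ - G i i = \sum_(j | j != i) G i j); last by ring.
  rewrite !mulr_sumr.
  apply: eq_bigr => j ji; rewrite -(perm_moment2 s ji) -mulr_suml.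
  by rewrite mulrA.
rewrite exchange_big /= mulr_sumr.
transitivity (\sum_i (N * d%:R * S2 * G i i + N * (P - S2) * (\sum_j G i j - G i i))).
  by apply: eq_bigr => i _; exact: e.
rewrite big_split /= -!mulr_sumr sumrB; ring.
Qed.

End permutation_moments.

(** * Jensen's inequality over the symmetric group *)

Section symmetrization.
Variable R : realType.

Lemma iint0 n : iint (fun _ : 'rV[R]_n => 0%E) = 0%E.
Proof. by elim: n => //= n ->; rewrite integral0. Qed.

Lemma iint_sum n (I : Type) (r : seq I) (F : I -> 'rV[R]_n -> R) :
  (forall i, measurable_real_on_rV (F i)) -> (forall i x, 0 <= F i x) ->
  (iint (fun x => (\sum_(i <- r) F i x)%:E) = \sum_(i <- r) iint (fun x => (F i x)%:E))%E.
Proof.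
move=> mF F0; elim: r => [|i r IH].
  by rewrite big_nil -[RHS](iint0 n); congr iint; apply/funext => x; rewrite big_nil.
rewrite big_cons -IH -iintD//.
- by congr iint; apply/funext => x; rewrite big_cons EFinD.
- by move=> d T h mh; apply/measurable_EFinP; exact: mF.
- move=> d T h mh; apply/measurable_EFinP; apply: measurable_sum => j; exact: mF.
- by move=> x; rewrite lee_fin.
- by move=> x; rewrite lee_fin sumr_ge0.
Qed.

(** Jensen's inequality for a convex decreasing function. As [hinge] is the maximum of 0 and
    [1 - t], each term is bounded below by whichever of the two is active at [a]. *)
Lemma hinge_average (I : finType) (x : I -> R) a :
  \sum_i x i <= #|I|%:R * a -> #|I|%:R * hinge a <= \sum_i hinge (x i).
Proof.
move=> h; rewrite [hinge a]/hinge; case: (leP 0 (1 - a)) => a1.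
  apply: (@le_trans _ _ (\sum_i (1 - x i))); last first.
    by apply: ler_sum => i _; rewrite /hinge le_max lexx orbT.
  by rewrite sumrB sumr_const mulrBr mulr1; apply: lerB.
by rewrite mulr0 sumr_ge0// => i _; exact: hinge_ge0.
Qed.

(** Permutation matrices preserve the orthant and Lebesgue measure, so the integral for [Q] equals
    the integral of the average of the permuted integrands, and these are compared pointwise by
    [hinge_average]. *)
Lemma orthant_integral_symmetrization n (Q Q0 : 'rV[R]_n -> R) :
  measurable_real_on_rV Q -> measurable_real_on_rV Q0 ->
  (forall s : 'rV[R]_n, (forall i, 0 <= s 0 i) ->
    \sum_(p : 'S_n) Q (s *m perm_mx p) <= #|{: 'S_n}|%:R * Q0 s) ->
  (orthant_integral Q0 <= orthant_integral Q)%E.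
Proof.
move=> mQ mQ0 QQ0; pose N : R := #|{: 'S_n}|%:R.
have N0 : 0 < N.
  by rewrite ltr0n; apply/card_gt0P; exists 1%g.
pose F (p : 'S_n) (s : 'rV[R]_n) : R := orthant s * hinge (Q (s *m perm_mx p)).
have F0 p s : 0 <= F p s by rewrite mulr_ge0 ?orthant_ge0 ?hinge_ge0.
have mQp p : measurable_real_on_rV (fun s => Q (s *m perm_mx p)).
  by move=> d T h mh; apply: mQ; exact: measurable_row_mul.
have mF p : measurable_real_on_rV (F p).
  move=> d T h mh; apply: measurable_funM; first exact: measurable_orthant.
  by apply: measurable_hinge; exact: mQp.
have Fp p : iint (fun s => (F p s)%:E) = orthant_integral Q.
  have up : (perm_mx p : 'M[R]_n) \in unitmx by rewrite unitmx_perm.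
  rewrite /orthant_integral -(iint_mulmx up (measurable_orthant_hinge mQ)); last first.
    exact: orthant_hinge_ge0.
  rewrite det_perm normrX normrN1 expr1n mul1e.
  by congr iint; apply/funext => s; rewrite orthant_perm.
have NQ : (N%:E * orthant_integral Q = iint (fun s => (\sum_p F p s)%:E))%E.
  rewrite iint_sum//; under eq_bigr do rewrite Fp.
  rewrite big_const_seq count_predT (_ : size _ = #|{: 'S_n}|); last first.
    by rewrite cardT enumT.
  rewrite /N; elim: #|_| => [|k IH]; first by rewrite mul0e.
  by rewrite iterS -IH -natr1 EFinD ge0_muleDl ?lee_fin// mul1e addeC.
rewrite -(@lee_pmul2l _ N%:E)// ?fin_numE// NQ -iintZl ?(ltW N0)//; last 2 first.
- exact: measurable_orthant_hinge.
- exact: orthant_hinge_ge0.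
apply: le_iint.
- move=> d T h mh; apply: measurable_funeM; exact: (measurable_orthant_hinge mQ0).
- by move=> d T h mh; apply/measurable_EFinP; apply: measurable_sum => p; exact: mF.
- by move=> s; rewrite mule_ge0 ?orthant_hinge_ge0 ?lee_fin ?(ltW N0).
move=> s; rewrite -EFinM lee_fin -mulr_sumr mulrCA orthantP.
case: forallP => [s0|_]; last by rewrite !mul0r.
by rewrite ler_wpM2l//; apply: hinge_average; exact: QQ0.
Qed.

End symmetrization.

(** * Hadamard's inequality *)

Section Hadamard.
Variable R : realType.

Lemma prodr_eq_le (I : finType) (a b : I -> R) : (forall i, 0 < a i) ->
  (forall i, a i <= b i) -> \prod_i b i <= \prod_i a i -> forall i, a i = b i.
Proof.
move=> a0 ab h i; apply/le_anti; rewrite ab /= leNgt; apply/negP => lt_ab.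
move: h; rewrite leNgt => /negP; apply.
rewrite (bigD1 i)//= [ltRHS](bigD1 i)//=.
apply: (@lt_le_trans _ _ (b i * \prod_(j | j != i) a j)).
  by rewrite ltr_pM2r// prodr_gt0.
rewrite ler_pM2l ?(lt_trans (a0 i))//.
by apply: ler_prod => j _; rewrite ab ltW.
Qed.

Definition posdef n (P : 'M[R]_n) := P^T = P /\ forall x : 'rV_n, x != 0 -> 0 < (x *m P *m x^T) 0 0.

Lemma posdef_diag n (P : 'M[R]_n) i : posdef P -> 0 < P i i.
Proof.
move=> [_ /(_ (delta_mx 0 i))].
rewrite trmx_delta -rowE -colE !mxE; apply.
by apply/eqP => /rowP /(_ i); rewrite !mxE !eqxx => /eqP; rewrite oner_eq0.
Qed.

(** Induction through the Schur complement [S] of the corner entry [a]: it is positive definite,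
    [det P = a det S], and its diagonal is that of [D] lowered by [b_i^2 / a]. Equality therefore
    forces [b = 0], hence [S = D], and the rest is the equality case for [S]. *)
Lemma Hadamard n (P : 'M[R]_n) : posdef P ->
  [/\ 0 < \det P, \det P <= \prod_i P i i &
      \prod_i P i i <= \det P -> forall i j, i != j -> P i j = 0].
Proof.
elim: n P => [|n IH] P pP.
  by rewrite det_mx00 big_ord0; split => // _ [].
pose a := P 0 0; pose b : 'rV_n := @ursubmx R 1 n 1 n P.
pose D : 'M[R]_n := @drsubmx R 1 n 1 n P.
have a0 : 0 < a by exact: posdef_diag.
pose S : 'M[R]_n := D - a^-1 *: (b^T *m b).
have e0 : lshift n (0 : 'I_1) = 0 :> 'I_(1 + n) by exact/val_inj.
have PE : P = block_mx a%:M b b^T D :> 'M[R]_(1 + n).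
  rewrite -[LHS](@submxK R 1 n 1 n); congr block_mx.
    by rewrite [LHS]mx11_scalar !mxE e0.
  apply/matrixP => i j; rewrite !mxE.
  by have /matrixP/(_ (rshift 1 i) (lshift n j)) := pP.1; rewrite mxE.
have PS : P = block_mx 1%:M 0 (a^-1 *: b^T) 1%:M *m block_mx a%:M b 0 S.
  rewrite PE mulmx_block !(mul1mx, mul0mx, mulmx0, addr0) mul_mx_scalar scalerA.
  by rewrite mulfV ?gt_eqF// scale1r -scalemxAl /S addrC subrK.
have detP : \det P = a * \det S.
  by rewrite PS (@det_mulmx _ (1 + n)) (@det_lblock _ 1 n) !det1 mul1r mul1r (@det_ublock _ 1 n) det_scalar expr1.
have pS : posdef S.
  split.
    rewrite /S linearB /= linearZ /= trmx_mul trmxK; congr (_ - _).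
    apply/matrixP => i j; rewrite !mxE.
    by have /matrixP/(_ (rshift 1 i) (rshift 1 j)) := pP.1; rewrite mxE.
  move=> x x0; pose t := (x *m b^T) 0 0.
  have tE : x *m b^T = t%:M by rewrite [LHS]mx11_scalar.
  have tE' : b *m x^T = t%:M by rewrite -[LHS]trmxK trmx_mul trmxK tE tr_scalar_mx.
  (* Among the vectors with tail [x] this one minimises the form of [P], and the minimum is the
     value of the form of [S] at [x]. *)
  pose y : 'rV_(1 + n) := row_mx (- a^-1 * t)%:M x.
  have y0 : y != 0.
    apply: contra x0 => /eqP /(congr1 (@rsubmx R 1 1 n)).
    by rewrite row_mxKr => ->; rewrite linear0.
  have := pP.2 y y0; rewrite PE (@mul_row_block R 1 1 n 1 n) tE.
  rewrite (@tr_row_mx R 1 1 n) (@mul_row_col R 1 1 n 1) !mulmxDl tr_scalar_mx.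
  rewrite -!scalar_mxM !mul_scalar_mx -!scalemxAl tE'.
  rewrite /S mulmxBr mulmxBl -scalemxAr -scalemxAl.
  rewrite [x *m (_ *m _)]mulmxA tE mul_scalar_mx -scalemxAl tE'.
  rewrite !mxE /= !mulr1n.
  set X := \sum_j _.
  by rewrite (_ : _ + _ + _ = X - a^-1 * (t * t)) //; field; rewrite gt_eqF.
have bb i : (b^T *m b) i i = b 0 i ^+ 2 by rewrite mxE big_ord1 mxE expr2.
have SiiE i : S i i = D i i - a^-1 * b 0 i ^+ 2.
  by rewrite -bb /S [LHS]mxE [X in _ + X]mxE [X in - X]mxE.
have SD i : S i i <= D i i.
  by rewrite SiiE gerBl mulr_ge0 ?invr_ge0 ?(ltW a0)// sqr_ge0.
have S0 i : 0 < S i i by exact: posdef_diag.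
have prodP : \prod_i P i i = a * \prod_i D i i.
  rewrite big_ord_recl; congr (_ * _); apply: eq_bigr => i _.
  by rewrite !mxE; congr (P _ _); exact/val_inj.
have [dS SH SE] := IH _ pS.
have S_le_D : \prod_i S i i <= \prod_i D i i.
  by apply: ler_prod => i _; rewrite SD ltW.
rewrite detP prodP; split; first by rewrite mulr_gt0.
  by rewrite ler_pM2l// (le_trans SH).
rewrite ler_pM2l// => DS.
have SDe := prodr_eq_le S0 SD (le_trans DS SH).
have b0 : b = 0.
  apply/rowP => i; rewrite [RHS]mxE; apply/eqP; rewrite -sqrf_eq0.
  have /eqP := SDe i; rewrite SiiE -subr_eq0 addrAC subrr add0r oppr_eq0 mulf_eq0.
  by rewrite invr_eq0 gt_eqF.
have SD' : S = D by rewrite /S b0 mulmx0 scaler0 subr0.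
have D0 := SE (le_trans S_le_D DS).
rewrite PE; change (forall i j : 'I_(1 + n), i != j -> block_mx a%:M b b^T D i j = 0).
move=> i j; have [k ->|k ->] := split_ordP i; have [l ->|l ->] := split_ordP j.
- by rewrite !ord1 eqxx.
- by rewrite block_mxEur b0 mxE.
- by rewrite block_mxEdl b0 !mxE.
- by rewrite block_mxEdr -SD' => kl; apply: D0; apply: contra kl => /eqP ->.
Qed.
End Hadamard.

(** * Extremal determinant and vertex norms *)

Section barycentric.
Variables (R : realType) (d : nat).
Implicit Types (w : 'I_d.+1 -> 'rV[R]_d) (rho : R).

Lemma dotv_hd_tl (y z : 'rV[R]_(1 + d)) : dotv y z = hd y * hd z + dotv (tl y) (tl z).
Proof.
rewrite [y in LHS]hd_tl [z in LHS]hd_tl /dotv tr_row_mx mul_row_col mxE.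
by rewrite tr_scalar_mx -scalar_mxM mxE eqxx mulr1n.
Qed.

Lemma mulmx_tr_dotv m n (M : 'M[R]_(m, n)) (N : 'M[R]_(m, n)) i j :
  (M *m N^T) i j = dotv (row i M) (row j N).
Proof. by rewrite dotvE mxE; apply: eq_bigr => k _; rewrite !mxE. Qed.

Lemma mulmx_dotv m n (y : 'rV[R]_m) (N : 'M[R]_(m, n)) i :
  (y *m N) 0 i = dotv y (row i N^T).
Proof. by rewrite dotvE mxE; apply: eq_bigr => k _; rewrite !mxE. Qed.

(* The barycentric coordinate functions of the simplex [w] are
   [x |-> hd (coface w i) + dotv x (tl (coface w i))]. *)
Definition coface w i : 'rV[R]_(1 + d) := row i (invmx (vmx w))^T.

Lemma barycentricE w x i :
  (hlift x *m invmx (vmx w)) 0 i = hd (coface w i) + dotv x (tl (coface w i)).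
Proof. by rewrite mulmx_dotv dotv_hd_tl hd_hlift tl_hlift mul1r. Qed.

Lemma barycentric_vertex w i j : vmx w \in unitmx ->
  hd (coface w i) + dotv (w j) (tl (coface w i)) = (j == i)%:R.
Proof.
move=> uw; rewrite -barycentricE -row_vmx -row_mul mulmxV//.
by rewrite !mxE.
Qed.

Lemma sum_hd_coface w : vmx w \in unitmx -> \sum_i hd (coface w i) = 1.
Proof.
move=> uw; rewrite -[RHS](hd_hlift (0 : 'rV[R]_d)).
rewrite -[X in hd X](mulmxKV uw) hd_mul_vmx; apply: eq_bigr => i _.
by rewrite barycentricE dotv0l addr0.
Qed.

Definition contains_ball rho w :=
  forall x, sqn x <= rho ^+ 2 -> forall i, 0 <= hd (coface w i) + dotv x (tl (coface w i)).

(* The Gram matrix of the regular simplex circumscribed about the ball of radius [rho]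
   centred at the origin, for which [a_i = 1 / (d + 1)] and [|w i| = d rho]. *)
Definition gram rho w := forall i j,
  dotv (w i) (w j) = d%:R * rho ^+ 2 * (d.+1%:R * (i == j)%:R - 1).

(** Used in two roles: with [c^2 = d rho^2] to prepare Hadamard's inequality, and with [c = -1] as
    the matrix of the Lorentz form. *)
Definition tail_scale (c : R) : 'M[R]_(1 + d) := diag_mx (row_mx 1%:M (const_mx c)).

Lemma mul_tail_scale (y : 'rV[R]_(1 + d)) c :
  y *m tail_scale c = row_mx (hd y)%:M (c *: tl y).
Proof.
apply/rowP => i; rewrite mul_mx_diag mxE.
have [j ->|j ->] := split_ordP i.
  by rewrite !row_mxEl !mxE !ord1 eqxx mulr1n mulr1.
by rewrite !row_mxEr !mxE mulrC.
Qed.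

Lemma det_tail_scale c : \det (tail_scale c) = c ^+ d.
Proof.
rewrite det_diag big_split_ord /= big_ord1 row_mxEl mxE eqxx mulr1n mul1r.
under eq_bigr do rewrite row_mxEr mxE.
by rewrite prodr_const card_ord.
Qed.

Lemma tail_scaleV c : c != 0 -> tail_scale c^-1 *m tail_scale c = 1%:M.
Proof.
move=> c0; rewrite /tail_scale mulmx_diag -[RHS]diag_const_mx; congr diag_mx.
apply/rowP => i; rewrite !mxE.
case: split_ordP => j _; first by rewrite !mxE ord1 eqxx mulr1.
by rewrite !mxE mulVf.
Qed.

Lemma dotv_tail_scale (y z : 'rV[R]_(1 + d)) c :
  dotv (y *m tail_scale c) (z *m tail_scale c) =
  hd y * hd z + c ^+ 2 * dotv (tl y) (tl z).
Proof.
rewrite !mul_tail_scale dotv_hd_tl !hd_row_mx !tl_row_mx dotvZl dotvZr.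
by rewrite mulrA -expr2.
Qed.

Lemma posdef_mulmx_tr n (M : 'M[R]_n) : M \in unitmx -> posdef (M *m M^T).
Proof.
move=> uM; split; first by rewrite trmx_mul trmxK.
move=> x x0; rewrite mulmxA -mulmxA -trmx_mul.
have -> : (x *m M *m (x *m M)^T) 0 0 = sqn (x *m M) by [].
rewrite sqn_gt0; apply: contra x0 => /eqP xM.
by rewrite -[x](mulmxK uM) xM mul0mx.
Qed.

(** When the rows of [M] are orthogonal and of equal length, its inverse transpose [W] is just
    [a M]. This carries the equality case over from the cofaces to the vertices. *)
Lemma mulmx_tr_scalarK n (M W : 'M[R]_n) a : a != 0 -> W *m M^T = 1%:M ->
  M *m M^T = (a^-1)%:M -> W *m W^T = a%:M.
Proof.
move=> a0 WM MM.
have aMM : (a *: M) *m M^T = 1%:M.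
  by rewrite -scalemxAl MM scale_scalar_mx mulfV.
have WE : W = a *: M.
  by rewrite -[W]mulmx1 -(mulmx1C aMM) mulmxA WM mul1mx.
by rewrite WE linearZ /= -scalemxAr aMM scalemx1.
Qed.

Section ball.
Variables (rho : R) (w : 'I_d.+1 -> 'rV[R]_d).
Hypotheses (d0 : (0 < d)%N) (rho0 : 0 < rho) (uw : vmx w \in unitmx).
Local Notation al i := (hd (coface w i)).
Local Notation be i := (tl (coface w i)).
Local Notation n := (d.+1%:R : R).

Section contains.
Hypothesis wB : contains_ball rho w.

Lemma coface_hd_ge0 i : 0 <= al i.
Proof.
have := @wB 0 _ i; rewrite dotv0l addr0; apply.
by rewrite /sqn dotv0l sqr_ge0.
Qed.

Lemma coface_le i : rho ^+ 2 * sqn (be i) <= al i ^+ 2.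
Proof.
have [b0|b0] := eqVneq (be i) 0; first by rewrite b0 /sqn dotv0l mulr0 sqr_ge0.
pose q := Num.sqrt (sqn (be i)).
have q0 : 0 < q by rewrite sqrtr_gt0 sqn_gt0.
have q2 : q ^+ 2 = sqn (be i) by rewrite sqr_sqrtr// sqn_ge0.
(* The point of the ball at which the i-th barycentric coordinate is smallest. *)
have := @wB (- (rho / q) *: be i) _ i.
rewrite sqnZ sqrrN exprMn exprVn q2 mulrVK ?unitfE ?sqn_eq0// => /(_ (lexx _)).
rewrite dotvZl -/(sqn _) -q2 mulNr subr_ge0.
have -> : rho / q * q ^+ 2 = rho * q by field; rewrite gt_eqF.
move=> h; rewrite -exprMn lerXn2r// nnegrE ?coface_hd_ge0// mulr_ge0 ?(ltW rho0) ?(ltW q0)//.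
Qed.

Lemma coface_hd_gt0 i : 0 < al i.
Proof.
rewrite lt_def coface_hd_ge0 andbT; apply/eqP => a0.
have := coface_le i; rewrite a0 expr0n /= pmulr_rle0 ?exprn_gt0// => b0.
have /eqP : sqn (be i) == 0 by rewrite eq_le b0 sqn_ge0.
move/eqP; rewrite sqn_eq0 => /eqP be0.
have := barycentric_vertex i i uw; rewrite a0 be0 dotv0r addr0 eqxx => /eqP.
by rewrite eq_sym oner_eq0.
Qed.

(* Tangent lines: [1 / a >= 2 n - n ^ 2 a] and [z ^ 2 >= 2 d z - d ^ 2], which are
   equalities at the regular simplex, where [a = 1 / n] and [z = 1 / a - 1 = d]. *)
Lemma sum_sqn_ge : n * d%:R ^+ 2 * rho ^+ 2 <= \sum_i sqn (w i).
Proof.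
have key i : rho ^+ 2 * (2 * d%:R * (2 * n - n ^+ 2 * al i - 1) - d%:R ^+ 2) <= sqn (w i).
  have a0 := coface_hd_gt0 i; have r2 : 0 < rho ^+ 2 by rewrite exprn_gt0.
  have h1 : (1 - al i) ^+ 2 <= sqn (w i) * sqn (be i).
    have -> : 1 - al i = dotv (w i) (be i).
      have <- : al i + dotv (w i) (be i) = 1 by rewrite barycentric_vertex// eqxx.
      by rewrite addrC addKr.
    exact: dotv_CauchySchwarz.
  have h2 := coface_le i; have w0 := sqn_ge0 (w i).
  pose z := (al i)^-1 - 1.
  have h3 : rho ^+ 2 * z ^+ 2 <= sqn (w i).
    have -> : z ^+ 2 = (1 - al i) ^+ 2 / al i ^+ 2 by rewrite /z; field; rewrite gt_eqF.
    rewrite mulrA ler_pdivrMr ?exprn_gt0//.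
    apply: (@le_trans _ _ (rho ^+ 2 * (sqn (w i) * sqn (be i)))); first by rewrite ler_pM2l.
    by rewrite mulrCA ler_wpM2l.
  apply: le_trans h3; rewrite ler_pM2l//.
  have h4 : 2 * n - n ^+ 2 * al i - 1 <= z.
    rewrite /z lerB// -(ler_pM2r a0) mulVf ?gt_eqF//.
    by have := sqr_ge0 (1 - n * al i); nra.
  have h5 : 0 <= (z - d%:R) ^+ 2 by exact: sqr_ge0.
  have d0' : 0 <= d%:R :> R by rewrite ler0n.
  by nra.
apply: le_trans (ler_sum _ (fun i _ => key i)).
rewrite -mulr_sumr sumrB -mulr_sumr !sumrB -[X in _ - X - _]mulr_sumr sum_hd_coface//.
have cst (x : R) : \sum_(i < d.+1) x = n * x.
  by rewrite sumr_const card_ord mulr_natl.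
rewrite !cst mulr1.
rewrite (_ : n = 1 + d%:R); last by rewrite -natr1 addrC.
by rewrite le_eqVlt; apply/orP; left; apply/eqP; ring.
Qed.

Lemma prod_hd_coface_le : \prod_i al i <= n^-1 ^+ d.+1 ?= iff
  [forall i, forall j, al i == al j].
Proof.
have := @leif_AGM R _ predT (fun i => al i) (fun i _ => coface_hd_ge0 i).
rewrite sum_hd_coface// cardT size_enum_ord div1r.
congr (_ <= _ ?= iff _).
Qed.

(** With [det P = K^d / det W^2], the bound is the chain [det P <= prod P_ii <= prod (n a_i^2) <=
    n^(-n)]. Under the reverse inequality every link is an equality: [P] is diagonal,
    [P_ii = n a_i^2] and [a_i = 1 / n], so [P] is the scalar matrix [1 / n], which determines the
    Gram matrix of the vertices. *)
Lemma det_vmx_bound : (d%:R * rho ^+ 2) ^+ d * n ^+ d.+1 <= \det (vmx w) ^+ 2 /\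
  (\det (vmx w) ^+ 2 <= (d%:R * rho ^+ 2) ^+ d * n ^+ d.+1 -> gram rho w).
Proof.
pose K := d%:R * rho ^+ 2.
have dR : 0 < d%:R :> R by rewrite ltr0n.
have K0 : 0 < K by rewrite mulr_gt0// exprn_gt0.
(* With this scaling the cofaces of the regular simplex become orthogonal, as equality in Hadamard's
   inequality demands. *)
pose c := Num.sqrt K; have c0 : 0 < c by rewrite sqrtr_gt0.
have c2 : c ^+ 2 = K by rewrite sqr_sqrtr// ltW.
have n0 : 0 < n by rewrite ltr0n.
pose M := (invmx (vmx w))^T *m tail_scale c.
have rowM i : row i M = coface w i *m tail_scale c by rewrite row_mul.
pose P := M *m M^T.
have PE i j : P i j = al i * al j + K * dotv (be i) (be j).
  by rewrite mulmx_tr_dotv !rowM dotv_tail_scale c2.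
have uM : M \in unitmx.
  rewrite unitmx_mul unitmx_tr unitmx_inv uw unitmxE det_tail_scale unitfE.
  by rewrite expf_neq0// gt_eqF.
have pP : posdef P by exact: posdef_mulmx_tr.
have [dP Hd Heq] := Hadamard pP.
have Pii i : P i i <= n * al i ^+ 2.
  rewrite PE -expr2 -/(sqn _) (_ : n = 1 + d%:R); last by rewrite -natr1 addrC.
  rewrite mulrDl mul1r lerD2l /K -mulrA ler_pM2l//; exact: coface_le.
have Pii0 i : 0 < P i i by exact: posdef_diag.
have prodP : \prod_i (n * al i ^+ 2) = n ^+ d.+1 * (\prod_i al i) ^+ 2.
  by rewrite big_split /= prodr_const card_ord prodrXl.
have [AM AMeq] := prod_hd_coface_le.
have nn0 : 0 < n ^+ d.+1 by exact: exprn_gt0.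
have al0 : 0 < \prod_i al i by apply: prodr_gt0 => i _; exact: coface_hd_gt0.
have XE : n ^+ d.+1 * (n^-1 ^+ d.+1) ^+ 2 = (n ^+ d.+1)^-1.
  by rewrite exprVn expr2 mulrA mulfV ?mul1r// gt_eqF.
have up : n ^+ d.+1 * (\prod_i al i) ^+ 2 <= (n ^+ d.+1)^-1.
  by rewrite -XE ler_pM2l// lerXn2r// nnegrE ?(ltW al0)// exprn_ge0// invr_ge0 ltW.
have Pprod : \prod_i P i i <= \prod_i (n * al i ^+ 2).
  by apply: ler_prod => i _; rewrite Pii ltW.
have W0 : 0 < \det (vmx w) ^+ 2.
  by rewrite lt_def sqr_ge0 sqrf_eq0 andbT -unitfE -unitmxE.
have detP : \det P = K ^+ d / \det (vmx w) ^+ 2.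
  rewrite det_mulmx det_tr -expr2 det_mulmx det_tr det_inv det_tail_scale.
  by rewrite exprMn exprVn mulrC exprAC c2.
split.
  have := le_trans Hd (le_trans Pprod _); rewrite prodP => /(_ _ up).
  rewrite detP ler_pdivrMr// mulrC => h.
  by rewrite -/K -ler_pdivlMr// mulrC.
move=> Wle.
have low : (n ^+ d.+1)^-1 <= \det P.
  by rewrite detP ler_pdivlMr// ler_pdivrMl// mulrC.
have Poff : forall i j, i != j -> P i j = 0.
  by apply: Heq; rewrite (le_trans Pprod)// prodP (le_trans up).
have Pdiag : forall i, P i i = n * al i ^+ 2.
  by apply: prodr_eq_le => //; rewrite prodP (le_trans up)// (le_trans low).
have alE i : al i = n^-1.
  have : \prod_i al i == n^-1 ^+ d.+1.
    rewrite eq_le AM /= -(ler_pXn2r (n := 2))// ?nnegrE ?(ltW al0)//.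
    by rewrite -(ler_pM2l nn0) XE (le_trans low)// (le_trans Hd)// -prodP.
  rewrite AMeq => /forallP /(_ i) /forallP ali.
  apply: (mulfI (lt0r_neq0 n0)); rewrite mulfV ?gt_eqF// -[RHS](sum_hd_coface uw).
  by rewrite (eq_bigr (fun=> al i)) => [|j _]; rewrite ?sumr_const ?card_ord ?mulr_natl// -(eqP (ali j)).
have PI : P = (n^-1)%:M.
  apply/matrixP => i j; rewrite [RHS]mxE; have [<-|/Poff ->//] := eqVneq i j.
  by rewrite Pdiag alE mulr1n expr2 mulrA mulfV ?mul1r// gt_eqF.
have WM : (vmx w *m tail_scale c^-1) *m M^T = 1%:M.
  rewrite trmx_mul trmxK tr_diag_mx -mulmxA [X in _ *m X]mulmxA -/(tail_scale c).
  by rewrite tail_scaleV ?gt_eqF// mul1mx mulmxV.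
have WW := mulmx_tr_scalarK (lt0r_neq0 n0) WM PI.
move=> i j; have /matrixP/(_ i j) := WW.
rewrite mulmx_tr_dotv !row_mul !row_vmx dotv_tail_scale !hd_hlift !tl_hlift mulr1 exprVn c2 mxE.
by move=> h; rewrite -/K mulr_natr -h addrC addKr mulVKf// gt_eqF.
Qed.

End contains.
End ball.
End barycentric.

(** * Regular simplices *)

Section gram.
Variables (R : realType) (d : nat).
Implicit Types (w : 'I_d.+1 -> 'rV[R]_d) (rho : R).
Hypothesis d0 : (0 < d)%N.
Local Notation n := (d.+1%:R : R).

Definition touches_ball rho w := forall i, exists x, sqn x <= rho ^+ 2 /\
  hd (coface w i) + dotv x (tl (coface w i)) = 0.

(** The cofaces are the basis dual to the lifted vertices, so they can be identified by checking
    pairings instead of inverting a matrix. *)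
Lemma coface_unique w i (nu : 'rV[R]_(1 + d)) : vmx w \in unitmx ->
  (forall j, dotv (hlift (w j)) nu = (j == i)%:R) -> nu = coface w i.
Proof.
move=> uw h; rewrite /coface trmx_inv rowE.
rewrite -[LHS](@mulmxK _ _ _ (vmx w)^T) ?unitmx_tr//; congr (_ *m _).
apply/rowP => j; rewrite mulmx_dotv trmxK row_vmx dotvC h !mxE eqxx /=.
by [].
Qed.

(** The numbers [hd (coface w i)] are the barycentric coordinates of the origin. *)
Lemma coface_origin w : vmx w \in unitmx -> \sum_i hd (coface w i) *: w i = 0.
Proof.
move=> uw; rewrite -[RHS](tl_hlift (0 : 'rV[R]_d)).
rewrite -[X in tl X](mulmxKV uw) tl_mul_vmx; apply: eq_bigr => i _.
by rewrite barycentricE dotv0l addr0.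
Qed.

Section gram_theory.
Variables (rho : R) (w : 'I_d.+1 -> 'rV[R]_d).
Hypotheses (rho0 : 0 < rho) (gw : gram rho w).
Let K := d%:R * rho ^+ 2.

Let K0 : 0 < K.
Proof. by rewrite mulr_gt0 ?exprn_gt0// ltr0n. Qed.

Let n0 : 0 < n. Proof. by rewrite ltr0n. Qed.

Lemma gram_det : \det (vmx w) ^+ 2 = (d%:R * rho ^+ 2) ^+ d * n ^+ d.+1.
Proof.
pose c := Num.sqrt K; have c0 : 0 < c by rewrite sqrtr_gt0.
have c2 : c ^+ 2 = K by rewrite sqr_sqrtr// ltW.
pose W := vmx w *m tail_scale d c^-1.
have WW : W *m W^T = n%:M.
  apply/matrixP => i j; rewrite mulmx_tr_dotv !row_mul !row_vmx dotv_tail_scale.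
  rewrite !hd_hlift !tl_hlift mulr1 exprVn c2 gw mulKf ?(lt0r_neq0 K0)// mxE.
  by rewrite addrC subrK mulr_natr.
have := congr1 determinant WW.
rewrite det_mulmx det_tr det_mulmx det_tail_scale det_scalar -expr2 exprMn exprAC exprVn c2.
by rewrite -/K => <-; rewrite exprVn mulrC mulfVK// expf_neq0// gt_eqF.
Qed.

Lemma gram_unit : vmx w \in unitmx.
Proof.
rewrite unitmxE unitfE -sqrf_eq0 gram_det mulf_neq0// expf_neq0//; exact: lt0r_neq0.
Qed.

Lemma gram_sqn i : sqn (w i) = d%:R ^+ 2 * rho ^+ 2.
Proof. by rewrite /sqn gw eqxx mulr1 -natr1 addrK; ring. Qed.

Lemma gram_coface i : coface w i = row_mx (n^-1)%:M ((n * K)^-1 *: w i).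
Proof.
apply/esym/coface_unique; first exact: gram_unit.
move=> j; rewrite dotv_hd_tl hd_hlift tl_hlift hd_row_mx tl_row_mx dotvZr gw -/K mul1r.
have := lt0r_neq0 n0; have := lt0r_neq0 K0; set b : R := _%:R; move=> *.
by field; apply/andP.
Qed.

Lemma gram_contains_ball : contains_ball rho w.
Proof.
move=> x xr i; rewrite gram_coface hd_row_mx tl_row_mx dotvZr.
have : dotv x (w i) ^+ 2 <= K ^+ 2.
  rewrite (le_trans (dotv_CauchySchwarz _ _))// gram_sqn.
  rewrite (_ : K ^+ 2 = rho ^+ 2 * (d%:R ^+ 2 * rho ^+ 2)); last by rewrite /K; ring.
  by rewrite ler_wpM2r// mulr_ge0// ?sqr_ge0.
set z := dotv x (w i) => zK.
have Kz : 0 <= K + z.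
  by rewrite leNgt; apply/negP => Kz; have := K0; nra.
have -> : n^-1 + (n * K)^-1 * z = (n * K)^-1 * (K + z).
  have := lt0r_neq0 n0; have := lt0r_neq0 K0; set m : R := _%:R => *.
  by field; apply/andP.
by rewrite mulr_ge0// invr_ge0 mulr_ge0// ltW.
Qed.

Lemma gram_touches_ball : touches_ball rho w.
Proof.
(* The centroid of the facet opposite to [w i], since the vertices sum to zero; its norm is [rho]
   because [|w i| = d rho]. *)
move=> i; exists (- d%:R^-1 *: w i).
have dR : d%:R != 0 :> R by rewrite pnatr_eq0 -lt0n.
split; first by rewrite sqnZ gram_sqn sqrrN exprVn mulKf ?expf_neq0.
rewrite gram_coface hd_row_mx tl_row_mx dotvZr dotvZl -/(sqn _) gram_sqn /K.
by field; rewrite dR !gt_eqF//= -natr1 addrC.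
Qed.

End gram_theory.

Lemma gram_exists rho : 0 < rho -> exists w, gram rho w.
Proof.
move=> r0; pose K := d%:R * rho ^+ 2.
have K0 : 0 < K by rewrite mulr_gt0 ?exprn_gt0// ltr0n.
have dR : d%:R != 0 :> R by rewrite pnatr_eq0 -lt0n.
pose c := Num.sqrt K; have c2 : c ^+ 2 = K by rewrite sqr_sqrtr// ltW.
pose a := Num.sqrt n; have a2 : a ^+ 2 = n by rewrite sqr_sqrtr.
(* Up to the factor [c], the vertices are [-(1,...,1)] and [a e_k + b (1,...,1)]. The condition
   [a + b d = 1] gives product -1 with the first vertex, and together with [a^2 = n] it implies
   [2 a b + b^2 d = -1], the product of two different other vertices. *)
pose b := (1 - a) / d%:R.
pose e (k : 'I_d) : 'rV[R]_d := a *: delta_mx 0 k + b *: const_mx 1.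
pose w i : 'rV[R]_d := c *: oapp e (- const_mx 1) (unlift ord0 i).
have dd k l : dotv (delta_mx 0 k : 'rV[R]_d) (delta_mx 0 l) = (k == l)%:R.
  rewrite dotvE (bigD1 k)//= !mxE !eqxx mul1r big1 ?addr0 => [|j jk].
    by rewrite andTb.
  by rewrite !mxE (negbTE jk) mul0r.
have d1 k : dotv (delta_mx 0 k : 'rV[R]_d) (const_mx 1) = 1.
  rewrite dotvE (bigD1 k)//= !mxE !eqxx mul1r big1 ?addr0// => j jk.
  by rewrite !mxE (negbTE jk) mul0r.
have d11 : dotv (const_mx 1 : 'rV[R]_d) (const_mx 1) = d%:R.
  rewrite dotvE; under eq_bigr do rewrite !mxE mul1r.
  by rewrite sumr_const card_ord.
exists w => i j; rewrite /w dotvZl dotvZr mulrA -expr2 c2 -/K; congr (_ * _).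
have nE : n = d%:R + 1 by rewrite natr1.
have bd : b * d%:R = 1 - a by rewrite /b divfK.
have ab : a * b + a * b + b * b * d%:R = -1.
  apply: (mulIf dR); rewrite (_ : _ * d%:R = a * (b * d%:R) *+ 2 + (b * d%:R) ^+ 2); last by ring.
  have dE : d%:R = a ^+ 2 - 1 by rewrite a2 nE addrK.
  by rewrite bd mulN1r dE; ring.
case: unliftP => [k ->|->]; case: unliftP => [l ->|->] /=.
- rewrite (inj_eq lift_inj) /e !(dotvDl, dotvDr, dotvZl, dotvZr) dd d1.
  rewrite (dotvC _ (delta_mx _ _)) d1 d11 -ab -a2; ring.
- rewrite /e dotvNr dotvDl !dotvZl d1 d11 bd; ring.
- rewrite /e dotvNl dotvDr !dotvZr dotvC d1 d11 bd; ring.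
- by rewrite dotvNl dotvNr opprK d11 mulr1 nE addrK.
Qed.

End gram.

(** * Injectivity of the inverse hyperbolic cosine *)

Section acosh.
Variable R : realType.

Let acosh_arg_gt0 (t : R) : 1 <= t -> 0 < t + Num.sqrt (t ^+ 2 - 1).
Proof. by move=> t1; rewrite ltr_wpDr ?sqrtr_ge0// (lt_le_trans ltr01). Qed.

Let acosh_argV (t : R) : 1 <= t ->
  (t + Num.sqrt (t ^+ 2 - 1))^-1 = t - Num.sqrt (t ^+ 2 - 1).
Proof.
move=> t1; have h := acosh_arg_gt0 t1.
apply: (mulfI (lt0r_neq0 h)); rewrite mulfV ?gt_eqF// mulrC -subr_sqr sqr_sqrtr; first by ring.
by rewrite subr_ge0 expr_ge1// (le_trans ler01).
Qed.

(** The number [e = t + sqrt (t^2 - 1)] has inverse [t - sqrt (t^2 - 1)], so [t] is recovered as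
    half of [e + 1 / e]. *)
Lemma acosh_inj (a b : R) : 1 <= a -> 1 <= b -> acosh a = acosh b -> a = b.
Proof.
move=> a1 b1 /ln_inj; rewrite !posrE => /(_ (acosh_arg_gt0 a1) (acosh_arg_gt0 b1)) e.
have := congr1 (fun x => x + x^-1) e; rewrite /= !acosh_argV// => h.
have : a *+ 2 = b *+ 2.
  by move: h; set u := Num.sqrt _; set v := Num.sqrt _ => h; rewrite !mulr2n; lra.
by move=> /eqP; rewrite eqrMn2r => /eqP.
Qed.

End acosh.

(** * Regular circumscribed simplices and the extremal Gram matrix *)

Section regular_gram.
Variables (R : realType) (d : nat).
Implicit Types (x y : 'rV[R]_d) (w : 'I_d.+1 -> 'rV[R]_d) (rho : R).
Hypothesis d0 : (0 < d)%N.
Local Notation n := (d.+1%:R : R).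

Lemma gram_regular g rho w : gram rho w -> regular g w.
Proof.
move=> gw i j k l /negbTE ij /negbTE kl; case: g => /=.
  by rewrite !sqnB /sqn !gw ij kl !eqxx.
by rewrite /sqn !gw ij kl !eqxx.
Qed.

(** The reversed Cauchy-Schwarz inequality for the timelike vectors [(1, x)] and [(1, y)]. With
    [t = |x| |y|] and [m] the scalar product, the difference of the two sides is
    [(t - m) (2 - m - t) + (|x| - |y|)^2]; both terms are nonnegative and vanish together only for
    [x = y]. *)
Lemma hyperbolic_CauchySchwarz x y : sqn x < 1 -> sqn y < 1 ->
  0 < 1 - dotv x y /\ (1 - sqn x) * (1 - sqn y) <= (1 - dotv x y) ^+ 2 ?= iff (x == y).
Proof.
move=> x1 y1; pose t := Num.sqrt (sqn x * sqn y).
have x0 := sqn_ge0 x; have y0 := sqn_ge0 y.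
have t0 : 0 <= t by exact: sqrtr_ge0.
have t2 : t ^+ 2 = sqn x * sqn y by rewrite sqr_sqrtr// mulr_ge0.
have mt : dotv x y <= t.
  by rewrite (le_trans (ler_norm _))// -sqrtr_sqr ler_wsqrtr// dotv_CauchySchwarz.
set A := sqn x in x1 x0 t2 *; set B := sqn y in y1 y0 t2 *; set m := dotv x y in mt *.
have t1 : t < 1.
  rewrite ltNge; apply/negP => t1; have : t ^+ 2 < 1 by rewrite t2 -/A -/B; nra.
  by rewrite expr2; nra.
have AB : 0 <= A + B - t *+ 2.
  by rewrite leNgt; apply/negP => AB; have := sqr_ge0 (A - B); rewrite mulr2n in AB; nra.
have tm : 0 <= (t - m) * (2 - m - t) by apply: mulr_ge0; lra.
have e : (1 - m) ^+ 2 - (1 - A) * (1 - B) = (t - m) * (2 - m - t) + (A + B - t *+ 2).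
  by rewrite (_ : (1 - A) * (1 - B) = 1 - A - B + t ^+ 2); [ring|rewrite t2; ring].
split; first lra.
split; first by rewrite -subr_ge0 e addr_ge0.
rewrite eq_sym -subr_eq0 e paddr_eq0// mulf_eq0.
rewrite (gt_eqF (_ : 0 < 2 - m - t)) ?orbF; last by lra.
rewrite subr_eq0 subr_eq0; apply/andP/eqP => [[/eqP tm' /eqP ABt]|xy].
  by apply/eqP; rewrite -subr_eq0 -sqn_eq0 sqnB -/A -/B -/m -tm' addrAC ABt subrr.
have BA : B = A by rewrite /B -xy.
have mA : m = A by rewrite /m -xy.
have tA : t = A by rewrite /t -/A -/B BA -expr2 sqrtr_sqr ger0_norm.
by rewrite tA mA BA mulr2n.
Qed.

Lemma vertex_inj w : vmx w \in unitmx -> injective w.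
Proof.
move=> uw i j wij; apply/eqP; rewrite -[_ == _]negbK; apply/negP => ij.
have := barycentric_vertex i i uw; rewrite wij barycentric_vertex// eqxx eq_sym (negbTE ij).
by move/eqP; rewrite eq_sym oner_eq0.
Qed.

Lemma touches_coface rho w i : contains_ball rho w -> touches_ball rho w -> 0 < rho ->
  hd (coface w i) ^+ 2 = rho ^+ 2 * sqn (tl (coface w i)).
Proof.
move=> wB wT r0; apply/le_anti; rewrite coface_le// andbT.
have [x [xr /eqP]] := wT i; rewrite addr_eq0 => /eqP ->.
rewrite sqrrN (le_trans (dotv_CauchySchwarz _ _))// ler_wpM2r// sqn_ge0//.
Qed.

Lemma eq_sqr_gt0 (a b : R) : 0 <= a -> 0 <= b -> a ^+ 2 = b ^+ 2 -> a = b.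
Proof. by move=> a0 b0 /eqP; rewrite eqrXn2// => /eqP. Qed.

Lemma sum_eq_const (f : 'I_d.+1 -> R) : (forall i j, f i = f j) ->
  \sum_i f i = 1 -> forall i, f i = n^-1.
Proof.
move=> fE f1 i; have n0 : n != 0 by rewrite pnatr_eq0.
apply: (mulfI n0); rewrite mulfV// -[RHS]f1 (eq_bigr (fun=> f i)) => [|j _]; last exact: fE.
by rewrite sumr_const card_ord mulr_natl.
Qed.

(** The common end of both geometries. Equal [a_i] make the origin the centroid, whence [S = - d D];
    the gradient of a barycentric coordinate is then a multiple of the vertex, and tangency fixes
    [S = d^2 rho^2]. *)
Lemma gram_of_symmetric rho w S D : 0 < rho -> vmx w \in unitmx ->
  (forall i, hd (coface w i) = n^-1) ->
  (forall i, hd (coface w i) ^+ 2 = rho ^+ 2 * sqn (tl (coface w i))) ->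
  (forall i, sqn (w i) = S) -> (forall i j, i != j -> dotv (w i) (w j) = D) ->
  gram rho w.
Proof.
move=> r0 uw al tc wS wD; have n0 : n != 0 by rewrite pnatr_eq0.
have dR : d%:R != 0 :> R by rewrite pnatr_eq0 -lt0n.
have nE : n = 1 + d%:R by rewrite -natr1 addrC.
have sw : \sum_i w i = 0.
  apply: (scalerI (invr_neq0 n0)); rewrite scaler0 -[RHS](coface_origin uw) scaler_sumr.
  by apply: eq_bigr => i _; rewrite al.
have SD : S = - (d%:R * D).
  apply/eqP; rewrite -addr_eq0; apply/eqP; rewrite -(dotv0r (w ord0)) -sw dotv_sumr.
  rewrite (bigD1 ord0)//= -/(sqn _) wS; congr (_ + _).
  rewrite (eq_bigr (fun=> D)) => [|j j0]; last by rewrite wD// eq_sym.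
  by rewrite sumr_const cardC1 card_ord mulr_natl.
have S0 : S != 0.
  apply/eqP => S0; have /eqP := barycentric_vertex ord0 ord0 uw.
  have /eqP := wS ord0; rewrite S0 sqn_eq0 => /eqP ->.
  rewrite al dotv0l addr0 eqxx invr_eq1 nE -subr_eq0 addrC addKr.
  by rewrite (negbTE dR).
pose i0 := @ord0 d.
have be : tl (coface w i0) = (d%:R / n / S) *: w i0.
  rewrite -(@coface_unique R d w i0 (row_mx (n^-1)%:M ((d%:R / n / S) *: w i0))) ?tl_row_mx//.
  move=> j; rewrite dotv_hd_tl hd_hlift tl_hlift hd_row_mx tl_row_mx dotvZr mul1r.
  have [->|ji] := eqVneq j i0.
    by rewrite -/(sqn _) wS divfK// -[X in X + _]div1r -mulrDl -nE divff.
  have D0 : D != 0 by apply: contra S0 => /eqP D0; rewrite SD D0 mulr0 oppr0.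
  rewrite wD// SD; transitivity (0 : R) => //; move: (n) n0 => m m0.
  by field; rewrite dR D0 m0.
have SE : S = d%:R ^+ 2 * rho ^+ 2.
  have := tc i0; rewrite al be sqnZ wS; move: (n) n0 => m m0 h.
  transitivity (S * (m ^+ 2 * m^-1 ^+ 2)); first by rewrite -exprMn mulfV// expr1n mulr1.
  by rewrite h; field; rewrite S0 m0.
have DE : D = - (d%:R * rho ^+ 2).
  by apply: (mulfI dR); rewrite -[LHS]opprK -SD SE; ring.
move=> i j; have [<-|ij] := eqVneq i j; last by rewrite wD// DE mulr0; ring.
by rewrite -/(sqn _) wS SE mulr1 nE; ring.
Qed.

End regular_gram.

Section regular_circumscribed.
Variables (R : realType) (d : nat) (rho : R) (w : 'I_d.+1 -> 'rV[R]_d).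
Hypotheses (d0 : (0 < d)%N) (rho0 : 0 < rho) (uw : vmx w \in unitmx).
Hypotheses (wB : contains_ball rho w) (wT : touches_ball rho w).
Local Notation n := (d.+1%:R : R).

Let tc i : hd (coface w i) ^+ 2 = rho ^+ 2 * sqn (tl (coface w i)).
Proof. exact: touches_coface. Qed.

Let i0 : 'I_d.+1 := ord0.
Let i1 : 'I_d.+1 := lift ord0 (Ordinal d0).

Let i01 : i0 != i1. Proof. exact: neq_lift. Qed.

(* The gradient of the i-th barycentric coordinate is proportional to [w i - g], with [g]
   the centroid, so all gradients have the same norm; as the facets touch the ball, the
   barycentric coordinates of its centre are then equal, whence [g = 0]. *)
Lemma euclidean_regular_gram : regular Euclidean w -> gram rho w.
Proof.
move=> rw; pose D i j := sqn (w i - w j); pose l := D i0 i1.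
have n0 : n != 0 by rewrite pnatr_eq0.
have DE i j : D i j = l * (i != j)%:R.
  have [->|ij] := eqVneq i j; first by rewrite /D subrr /sqn dotv0l mulr0.
  rewrite mulr1; apply: (eq_sqr_gt0 _ _ _); rewrite ?sqn_ge0//.
  have := rw _ _ _ _ ij i01; rewrite /= => /(congr1 (fun x => x ^+ 2)).
  by rewrite !sqr_sqrtr ?sqn_ge0// /l /D => ->.
have l0 : l != 0.
  by rewrite /l /D sqn_eq0 subr_eq0; apply: contra i01 => /eqP /(vertex_inj uw) ->.
pose g := n^-1 *: \sum_j w j.
have wg i : w i - g = n^-1 *: \sum_j (w i - w j).
  have cst : \sum_(j < d.+1) w i = n *: w i by rewrite sumr_const card_ord scaler_nat.
  by rewrite sumrB cst scalerBr -/g scalerA mulVf// scale1r.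
have sumD i : \sum_j D i j = d%:R * l.
  under eq_bigr do rewrite DE; rewrite -mulr_sumr mulrC (bigD1 i)//= eqxx add0r.
  rewrite (eq_bigr (fun=> 1)) => [|j ji]; last by rewrite eq_sym ji.
  by rewrite sumr_const cardC1 card_ord.
have polar a b c : dotv (w a - w b) (w b - w c) = (D a c - D a b - D b c) / 2.
  have -> : D a c = sqn ((w a - w b) + (w b - w c)) by rewrite addrA subrK.
  by rewrite sqnD /D -mulr_natr; field.
have inner i j : dotv (w j - w i) (w i - g) = - l / 2 * (i != j)%:R.
  have [->|ij] := eqVneq i j; first by rewrite subrr dotv0l mulr0.
  rewrite wg dotvZr dotv_sumr; under eq_bigr do rewrite polar.
  rewrite -mulr_suml !sumrB !sumD (_ : \sum_(k < d.+1) D j i = n * l).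
    by rewrite mulr1; move: (n) n0 => m m0; field.
  by rewrite sumr_const card_ord mulr_natl DE eq_sym ij mulr1.
have be i : tl (coface w i) = (2 / l) *: (w i - g).
  rewrite -(@coface_unique R d w i (row_mx (1 - 2 / l * dotv (w i) (w i - g))%:M
    ((2 / l) *: (w i - g)))) ?tl_row_mx// => j.
  rewrite dotv_hd_tl hd_hlift tl_hlift hd_row_mx tl_row_mx dotvZr mul1r.
  rewrite -addrA -mulrN -mulrDr -dotvNl -dotvDl addrC [- _ + _]addrC inner.
  rewrite [i == j]eq_sym; case: eqVneq => _ /=; first by rewrite mulr0 mulr0 add0r.
  by rewrite mulr1; field.
have sbe i : sqn (tl (coface w i)) = 2 / l * (d%:R / n).
  have h : n * sqn (w i - g) = d%:R * l / 2.
    rewrite /sqn {1}wg dotvZl mulrA mulfV// mul1r dotv_suml.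
    under eq_bigr => j _ do rewrite -[w i - w j]opprB dotvNl inner.
    rewrite sumrN -mulr_sumr.
    have := sumD i; under eq_bigr do rewrite DE.
    rewrite -mulr_sumr => h; rewrite mulNr mulNr opprK mulrAC h //.
  rewrite be sqnZ (_ : sqn (w i - g) = d%:R * l / 2 / n).
    by move: (n) n0 => m m0; field; rewrite m0 l0.
  by apply: (mulfI n0); rewrite h; move: (n) n0 => m m0; field.
have al : forall i, hd (coface w i) = n^-1.
  apply: sum_eq_const; last exact: sum_hd_coface.
  move=> i j; apply: eq_sqr_gt0; rewrite ?(coface_hd_ge0 wB)//.
  by rewrite !tc !sbe.
have g0 : g = 0.
  rewrite -(coface_origin uw) /g scaler_sumr; apply: eq_bigr => i _.
  by rewrite al.
have wS i : sqn (w i) = sqn (w i0).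
  have := sbe i; rewrite be g0 subr0 sqnZ -(sbe i0) be g0 subr0 sqnZ.
  by move/mulfI; apply; rewrite expf_neq0// mulf_neq0// invr_neq0.
apply: (@gram_of_symmetric R d d0 rho w (sqn (w i0)) (sqn (w i0) - l / 2)) => // i j ij.
have := DE i j; rewrite /D sqnB !wS ij mulr1 => <-.
by field.
Qed.

(* The unit timelike lifts [E i = mu i * (1, w i)] have pairwise Lorentz product [k], so
   the i-th coface is [mu i] times the Lorentz dual of [x E_i + y sum_j E_j], where [x]
   and [y] depend only on [k]. As the facets touch the ball, [x mu_i + y sum_j mu_j] is
   independent of [i], and so is [mu i]. *)
Lemma hyperbolic_regular_gram : rho < 1 -> (forall i, sqn (w i) < 1) ->
  regular Hyperbolic w -> gram rho w.
Proof.
move=> rho1 w1 rw; have n0 : n != 0 by rewrite pnatr_eq0.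
pose mu i := (Num.sqrt (1 - sqn (w i)))^-1.
have s0 i : 0 < 1 - sqn (w i) by rewrite subr_gt0.
have mu0 i : 0 < mu i by rewrite invr_gt0 sqrtr_gt0.
have mu2 i : mu i ^+ 2 * (1 - sqn (w i)) = 1.
  by rewrite exprVn sqr_sqrtr ?mulVf ?gt_eqF// ltW.
pose kap i j := (1 - dotv (w i) (w j)) * (mu i * mu j).
have kapE i j : (1 - dotv (w i) (w j)) / Num.sqrt ((1 - sqn (w i)) * (1 - sqn (w j))) = kap i j.
  by rewrite /kap /mu sqrtrM ?(ltW (s0 i))// invfM.
have kap1 i j : i != j -> 1 < kap i j.
  move=> ij; have [m0 m1] := hyperbolic_CauchySchwarz (w1 i) (w1 j).
  have : (1 - sqn (w i)) * (1 - sqn (w j)) < (1 - dotv (w i) (w j)) ^+ 2.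
    have [le eqv] := m1; rewrite lt_neqAle le eqv andbT.
    by apply: contra ij => /eqP /(vertex_inj uw) ->.
  move=> h.
  have k0 : 0 < kap i j by rewrite !mulr_gt0.
  rewrite -(@ltr_pXn2r _ 2)// ?nnegrE ?ler01 ?(ltW k0)// expr1n.
  have -> : kap i j ^+ 2 = (mu i ^+ 2 * mu j ^+ 2) * (1 - dotv (w i) (w j)) ^+ 2.
    by rewrite /kap; ring.
  have e1 : 1 = (mu i ^+ 2 * mu j ^+ 2) * ((1 - sqn (w i)) * (1 - sqn (w j))).
    by rewrite mulrACA !mu2 mulr1.
  by rewrite [ltLHS]e1 ltr_pM2l// mulr_gt0// exprn_gt0.
have [k kdef] : exists k, kap i0 i1 = k by exists (kap i0 i1).
have k1 : 1 < k by rewrite -kdef; exact: kap1.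
have kE i j : i != j -> kap i j = k.
  move=> ij; have := rw _ _ _ _ ij i01; rewrite /= !kapE kdef => /acosh_inj; apply.
    exact: ltW (kap1 _ _ ij).
  exact: ltW.
pose F (y : 'rV[R]_(1 + d)) : 'rV[R]_(1 + d) := row_mx (hd y)%:M (- tl y).
pose E i := mu i *: hlift (w i).
have FE y z : dotv y (F z) = hd y * hd z - dotv (tl y) (tl z).
  by rewrite dotv_hd_tl hd_row_mx tl_row_mx dotvNr.
have FD y z : F (y + z) = F y + F z.
  by apply: hd_tl_eq; rewrite /F ?hdD ?tlD ?hd_row_mx ?tl_row_mx ?hdD ?tlD ?opprD.
have EE i j : dotv (E i) (F (E j)) = k + (1 - k) * (i == j)%:R.
  rewrite FE /E !hdZ !tlZ !hd_hlift !tl_hlift !mulr1 dotvZl dotvZr.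
  have [->|ij] := eqVneq i j; first by rewrite mulr1 -/(sqn _) subrKC -(mu2 j); ring.
  by rewrite mulr0 addr0 -(kE _ _ ij) /kap; ring.
pose U := \sum_i E i.
pose u := d%:R * k + 1.
have EU i : dotv (E i) (F U) = u.
  have -> : F U = \sum_j F (E j).
    have F0 : F 0 = 0.
      by apply: hd_tl_eq; rewrite /F ?hd_row_mx// tl_row_mx /tl linear0 oppr0.
    by rewrite /U; elim/big_rec2: _ => // j y z _ <-; rewrite FD.
  rewrite dotv_sumr; under eq_bigr do rewrite EE.
  rewrite big_split /= -mulr_sumr sumr_const card_ord (bigD1 i)//= eqxx big1 => [|j ji].
    by rewrite addr0 mulr1 /u mulrS -[k *+ d]mulr_natl; ring.
  by rewrite eq_sym (negbTE ji).
have UE i : dotv U (F (E i)) = u.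
  rewrite -(EU i) !FE mulrC; congr (_ - _); exact: dotvC.
have UU : dotv U (F U) = n * u.
  rewrite {1}/U dotv_suml; under eq_bigr do rewrite EU.
  by rewrite sumr_const card_ord mulr_natl.
have Ehd i : hd (E i) = mu i by rewrite hdZ hd_hlift mulr1.
have EV j : hlift (w j) = (mu j)^-1 *: E j by rewrite scalerA mulVf ?scale1r// gt_eqF.
clearbody U E.
have u0 : 0 < u by rewrite ltr_wpDl// mulr_ge0// ltW// (lt_trans ltr01).
(* Solves [x (1 - k) = 1] and [x k + y u = 0], which make the Lorentz product of [E j] with [C i]
   equal to 1 for [i = j] and 0 otherwise. *)
pose x := (1 - k)^-1; pose y := - (x * k / u).
have x0 : x != 0 by rewrite invr_neq0// subr_eq0 lt_eqF.
have x1k : x * (1 - k) = 1 by rewrite mulVf// subr_eq0 lt_eqF.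
pose C i := x *: E i + y *: U.
have coE i : coface w i = mu i *: F (C i).
  apply/esym/coface_unique => // j.
  rewrite EV.
  rewrite dotvZl dotvZr FE hdD tlD !hdZ !tlZ dotvDr !dotvZr.
  rewrite (_ : _ - _ = x * dotv (E j) (F (E i)) + y * dotv (E j) (F U)); last first.
    by rewrite !FE; ring.
  rewrite EE EU /y mulNr divfK ?(lt0r_neq0 u0)//; have [->|ji] := eqVneq j i.
    rewrite mulr1 subrKC mulr1 (_ : x + - (x * k) = x * (1 - k)); last by ring.
    by rewrite x1k mulr1 mulVf// gt_eqF.
  by rewrite mulr0 addr0 subrr !mulr0.
have alE i : hd (coface w i) = mu i * (x * mu i + y * hd U).
  by rewrite coE hdZ /F hd_row_mx hdD !hdZ Ehd.
pose q := x ^+ 2 + 2 * x * y * u + y ^+ 2 * (n * u).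
have CC i : dotv (C i) (F (C i)) = q.
  rewrite FE hdD tlD !hdZ !tlZ !dotvDl !dotvDr !dotvZl !dotvZr.
  have h1 := EE i i; have h2 := EU i; have h3 := UE i; have h4 := UU.
  rewrite eqxx mulr1 subrKC in h1; move: h1 h2 h3 h4; rewrite !FE.
  move=> h1 h2 h3 h4.
  rewrite /q -h4 (_ : x ^+ 2 = x ^+ 2 * (hd (E i) * hd (E i) - dotv (tl (E i)) (tl (E i)))).
    rewrite (_ : 2 * x * y * u = x * y * (hd (E i) * hd U - dotv (tl (E i)) (tl U)) +
      x * y * (hd U * hd (E i) - dotv (tl U) (tl (E i)))); first by ring.
    by rewrite h2 h3; ring.
  by rewrite h1 mulr1.
(* The Lorentz square of the i-th coface is [mu_i^2 q], and tangency makes it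
   [a_i^2 (1 - 1 / rho^2)]; here [a_i = mu_i (x mu_i + y hd U)], so [mu_i^2] cancels. *)
have sq i : (x * mu i + y * hd U) ^+ 2 * (1 - (rho ^+ 2)^-1) = q.
  have r2 : rho ^+ 2 != 0 by rewrite expf_neq0// gt_eqF.
  have m2 : mu i ^+ 2 != 0 by rewrite expf_neq0// gt_eqF.
  apply: (mulfI m2); rewrite mulrA -exprMn -alE mulrBr mulr1.
  rewrite {2}tc mulrAC mulfV// mul1r coE hdZ tlZ sqnZ exprMn -mulrBr -(CC i).
  by rewrite FE /F hd_row_mx tl_row_mx sqnN expr2.
have pos i : 0 < x * mu i + y * hd U.
  by rewrite -(pmulr_rgt0 _ (mu0 i)) -alE; exact: (coface_hd_gt0 rho0 uw wB).
have muE i j : mu i = mu j.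
  have r1 : 1 - (rho ^+ 2)^-1 != 0.
    rewrite subr_eq0 eq_sym invr_eq1 lt_eqF// expr_lt1//; exact: ltW.
  have /(mulIf r1) : (x * mu i + y * hd U) ^+ 2 * (1 - (rho ^+ 2)^-1) =
      (x * mu j + y * hd U) ^+ 2 * (1 - (rho ^+ 2)^-1) by rewrite !sq.
  by move/(eq_sqr_gt0 (ltW (pos i)) (ltW (pos j)))/addIr/(mulfI x0).
have al : forall i, hd (coface w i) = n^-1.
  apply: sum_eq_const; last exact: sum_hd_coface.
  by move=> i j; rewrite !alE (muE i j).
have wS i : sqn (w i) = sqn (w i0).
  have m2 : mu i0 ^+ 2 != 0 by rewrite expf_neq0// gt_eqF.
  have : mu i0 ^+ 2 * (1 - sqn (w i)) = mu i0 ^+ 2 * (1 - sqn (w i0)).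
    by rewrite mu2 (muE i0 i) mu2.
  by move/(mulfI m2)/(addrI 1)/oppr_inj.
apply: (@gram_of_symmetric R d d0 rho w (sqn (w i0)) (1 - k / (mu i0 * mu i0))) => // i j ij.
have m2 : mu i0 * mu i0 != 0 by rewrite mulf_neq0// gt_eqF.
apply: (mulfI m2); rewrite -(kE _ _ ij) /kap (muE i i0) (muE j i0).
by field; rewrite gt_eqF.
Qed.

End regular_circumscribed.

(** * Isometries moving a point to the origin *)

Section isometries.
Variables (R : realType) (d : nat).
Implicit Types (x y c : 'rV[R]_d) (s t : 'rV[R]_(1 + d)).

Definition lorentz s t : R := hd s * hd t - dotv (tl s) (tl t).

Lemma lorentzC s t : lorentz s t = lorentz t s.
Proof. by rewrite /lorentz mulrC dotvC. Qed.

Lemma lorentzDl s t u : lorentz (s + t) u = lorentz s u + lorentz t u.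
Proof. by rewrite /lorentz hdD tlD dotvDl; ring. Qed.

Lemma lorentzZl a s t : lorentz (a *: s) t = a * lorentz s t.
Proof. by rewrite /lorentz hdZ tlZ dotvZl; ring. Qed.

Lemma lorentzDr s t u : lorentz u (s + t) = lorentz u s + lorentz u t.
Proof. by rewrite lorentzC lorentzDl !(lorentzC u). Qed.

Lemma lorentzZr a s t : lorentz t (a *: s) = a * lorentz t s.
Proof. by rewrite lorentzC lorentzZl (lorentzC s). Qed.

Lemma lorentzNl s t : lorentz (- s) t = - lorentz s t.
Proof. by rewrite -scaleN1r lorentzZl mulN1r. Qed.

Lemma lorentzNr s t : lorentz t (- s) = - lorentz t s.
Proof. by rewrite lorentzC lorentzNl (lorentzC s). Qed.

Lemma lorentz_hlift x y : lorentz (hlift x) (hlift y) = 1 - dotv x y.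
Proof. by rewrite /lorentz !hd_hlift !tl_hlift mulr1. Qed.

Lemma lorentz_qform s : lorentz s s = qform Hyperbolic s.
Proof. by rewrite /qform mul1r /lorentz expr2. Qed.

Lemma gdist_lorentz x y : gdist Hyperbolic x y =
  acosh (lorentz (hlift x) (hlift y) /
    Num.sqrt (lorentz (hlift x) (hlift x) * lorentz (hlift y) (hlift y))).
Proof. by rewrite !lorentz_hlift. Qed.

Lemma lorentz_gdist a b s t x y : 0 < a -> 0 < b -> s = a *: hlift x -> t = b *: hlift y ->
  acosh (lorentz s t / Num.sqrt (lorentz s s * lorentz t t)) = gdist Hyperbolic x y.
Proof.
move=> a0 b0 -> ->; rewrite gdist_lorentz !lorentzZl !lorentzZr; congr (acosh _).
set p := lorentz _ _; set q := lorentz (hlift x) (hlift x); set r := lorentz (hlift y) _.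
have -> : a * (a * q) * (b * (b * r)) = (a * b) ^+ 2 * (q * r) by ring.
rewrite sqrtrM ?sqr_ge0// sqrtr_sqr gtr0_norm ?mulr_gt0//.
by rewrite mulrA -mulf_div mulfV ?mul1r// mulf_neq0// gt_eqF.
Qed.

(** Here [a] stands for [2 / <D, D>], so the map is minus the Lorentz reflection in the hyperplane
    orthogonal to [D]. *)
Lemma halfturn_lorentz a D t u : lorentz D D * a = 2 ->
  lorentz (- t + (lorentz t D * a) *: D) (- u + (lorentz u D * a) *: D) = lorentz t u.
Proof.
move=> Da; rewrite !(lorentzDl, lorentzDr, lorentzZl, lorentzZr, lorentzNl, lorentzNr).
rewrite (lorentzC D).
transitivity (lorentz t u + lorentz t D * lorentz u D * a * (lorentz D D * a - 2)).
  by ring.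
by rewrite Da subrr mulr0 addr0.
Qed.

Lemma halfturn_involutive a D t : lorentz D D * a = 2 ->
  let u := - t + (lorentz t D * a) *: D in - u + (lorentz u D * a) *: D = t.
Proof.
move=> Da /=; rewrite lorentzDl lorentzNl lorentzZl opprD opprK -addrA -scaleNr -scalerDl.
rewrite [X in X *: _](_ : _ = lorentz t D * a * (lorentz D D * a - 2)); last by ring.
by rewrite Da subrr mulr0 scale0r addr0.
Qed.

Section boost.
Variable c : 'rV[R]_d.
Hypothesis c1 : sqn c < 1.

Let s := (Num.sqrt (1 - sqn c))^-1.
Let s0 : 0 < s. Proof. by rewrite invr_gt0 sqrtr_gt0 subr_gt0. Qed.
Let s2 : s ^+ 2 * (1 - sqn c) = 1.
Proof. by rewrite exprVn sqr_sqrtr ?mulVf ?gt_eqF ?subr_ge0 ?subr_gt0// ltW. Qed.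

Let C := s *: hlift c.
Let e0 : 'rV[R]_(1 + d) := hlift 0.
Let D := C + e0.

Let CC : lorentz C C = 1.
Proof. by rewrite lorentzZl lorentzZr lorentz_hlift mulrA -expr2. Qed.

Let ee : lorentz e0 e0 = 1. Proof. by rewrite lorentz_hlift dotv0l subr0. Qed.

Let Ce : lorentz C e0 = s.
Proof. by rewrite lorentzZl lorentz_hlift dotv0r subr0 mulr1. Qed.

Let DD : lorentz D D = 2 * (1 + s).
Proof. by rewrite /D lorentzDl !lorentzDr CC ee Ce (lorentzC e0) Ce; ring. Qed.

Let s1 : 1 + s != 0. Proof. by rewrite gt_eqF// addr_gt0. Qed.

(* The half-turn exchanging the unit timelike vectors [C] (the centre) and [e0]
   (the origin): minus the reflection in the hyperplane orthogonal to [C + e0]. *)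
Definition boost_mx : 'M[R]_(1 + d) :=
  - 1%:M + (1 + s)^-1 *: ((D *m tail_scale d (-1))^T *m D).

Definition boost x : 'rV[R]_d :=
  (hd (hlift x *m boost_mx))^-1 *: tl (hlift x *m boost_mx).

Let boostE t : t *m boost_mx = - t + (lorentz t D / (1 + s)) *: D.
Proof.
rewrite /boost_mx mulmxDr mulmxN mulmx1; congr (_ + _).
rewrite -scalemxAr mulmxA [t *m _]mx11_scalar mul_scalar_mx scalerA mulrC.
congr ((_ * _) *: _); rewrite -/(dotv t _) mul_tail_scale dotv_hd_tl hd_row_mx tl_row_mx.
by rewrite /lorentz scaleN1r dotvNr.
Qed.

Let boost_lorentz t u : lorentz (t *m boost_mx) (u *m boost_mx) = lorentz t u.
Proof.
by rewrite !boostE; apply: halfturn_lorentz; rewrite DD mulfK.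
Qed.

Let boostK : boost_mx *m boost_mx = 1%:M.
Proof.
apply/row_matrixP => i; rewrite row_mul rowE !boostE.
rewrite halfturn_involutive ?DD ?mulfK// rowE mulmx1 //.
Qed.

Let boost_C : C *m boost_mx = e0.
Proof.
by rewrite boostE /D lorentzDr CC Ce mulfV// scale1r addKr.
Qed.

Let boost_e : e0 *m boost_mx = C.
Proof. by rewrite -boost_C -mulmxA boostK mulmx1. Qed.

(** The height of a vector is its Lorentz product with [e0], the image of [C]; by invariance it
    equals [s (1 - <x, c>)], and Cauchy-Schwarz makes this positive. *)
Let hd_boost x : sqn x < 1 -> 0 < hd (hlift x *m boost_mx).
Proof.
move=> x1; have -> : hd (hlift x *m boost_mx) = lorentz (hlift x *m boost_mx) e0.
  by rewrite /lorentz hd_hlift tl_hlift dotv0r subr0 mulr1.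
rewrite -boost_C boost_lorentz lorentzZr lorentz_hlift mulr_gt0// subr_gt0.
have := dotv_CauchySchwarz x c; have := sqn_ge0 x; have := sqn_ge0 c => c0 x0 h.
rewrite ltNge; apply/negP => m1.
have : dotv x c ^+ 2 < 1 by rewrite (le_lt_trans h)// mulr_ilt1.
by rewrite expr2; nra.
Qed.

Let hlift_boost x : sqn x < 1 ->
  hlift x *m boost_mx = hd (hlift x *m boost_mx) *: hlift (boost x).
Proof.
move=> x1; apply: hd_tl_eq; rewrite ?hdZ ?tlZ ?hd_hlift ?mulr1//.
by rewrite tl_hlift scalerA mulfV ?scale1r// gt_eqF// hd_boost.
Qed.

Lemma boost_isometry : isometry_by Hyperbolic boost_mx boost.
Proof.
split.
- by case/mulmx1_unit : boostK.
- have := congr1 (fun M => `|\det M|) boostK; rewrite det_mulmx det1 normr1 normrM -expr2.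
  by move/eqP; rewrite sqrp_eq1// => /eqP.
- by move=> t; rewrite -!lorentz_qform boost_lorentz.
- by move=> x x1; exists (hd (hlift x *m boost_mx)); [exact: hd_boost|exact: hlift_boost].
- move=> x y x1 y1.
  rewrite -(lorentz_gdist (hd_boost x1) (hd_boost y1) (hlift_boost x1) (hlift_boost y1)).
  by rewrite !boost_lorentz gdist_lorentz.
Qed.

Lemma boost_center : boost c = 0.
Proof.
rewrite /boost; have -> : hlift c = s^-1 *: C by rewrite scalerA mulVf ?scale1r// gt_eqF.
by rewrite -scalemxAl boost_C tlZ tl_hlift !scaler0.
Qed.

Lemma boost_involutive x : sqn x < 1 -> boost (boost x) = x.
Proof.
move=> x1; have h := hd_boost x1.
have e : hlift (boost x) *m boost_mx = (hd (hlift x *m boost_mx))^-1 *: hlift x.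
  apply: (scalerI (lt0r_neq0 h)); rewrite scalerA mulfV ?gt_eqF// scale1r.
  by rewrite scalemxAl -hlift_boost// -mulmxA boostK mulmx1.
by rewrite {1}/boost e hdZ tlZ hd_hlift tl_hlift mulr1 invrK scalerA mulfV ?scale1r ?gt_eqF.
Qed.

End boost.

Lemma translation_isometry c :
  isometry_by Euclidean (block_mx 1%:M (- c) 0 1%:M) (fun x => x - c).
Proof.
have uL : \det (block_mx 1%:M (- c) 0 1%:M : 'M[R]_(1 + d)) = 1.
  by rewrite det_ublock !det1 mulr1.
split.
- by rewrite unitmxE uL unitr1.
- by rewrite uL normr1.
- move=> t; rewrite /qform !mul0r !subr0; congr (_ ^+ 2).
  rewrite [t in LHS]hd_tl mul_row_block mulmx1 mulmx0 addr0.
  by rewrite hd_row_mx.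
- move=> x _; exists 1 => //; rewrite scale1r /hlift mul_row_block.
  by rewrite mulmx1 mulmx0 addr0 mul1mx mulmx1 addrC.
- by move=> x y _ _ /=; rewrite opprB addrA subrK.
Qed.

Lemma isometry_to_origin g c : in_space g c -> exists L L' T T',
  [/\ isometry_by g L T, isometry_by g L' T', T c = 0,
      forall x, in_space g x -> T' (T x) = x & forall x, in_space g x -> T (T' x) = x].
Proof.
case: g => /= cs.
  exists (block_mx 1%:M (- c) 0 1%:M), (block_mx 1%:M (- - c) 0 1%:M).
  exists (fun x => x - c), (fun x => x - - c).
  by split; [exact: translation_isometry|exact: translation_isometry|rewrite subrr|
    move=> x _; rewrite opprK subrK|move=> x _; rewrite opprK addrK].
exists (boost_mx c), (boost_mx c), (boost c), (boost c).
by split; [exact: boost_isometry|exact: boost_isometry|exact: boost_center|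
  exact: boost_involutive|exact: boost_involutive].
Qed.

End isometries.

(** * Balls centred at the origin *)

Section balls.
Variables (R : realType) (d : nat).

Lemma euclidean_ball_origin (r : R) (x : 'rV[R]_d) : 0 < r ->
  gball Euclidean 0 r x <-> sqn x <= r ^+ 2.
Proof.
move=> r0; rewrite /gball /= sub0r sqnN; split=> [[_ h]|h].
  by rewrite -[leLHS]sqr_sqrtr ?sqn_ge0// lerXn2r// nnegrE ?sqrtr_ge0// ltW.
split=> //; rewrite -[leRHS]ger0_norm ?(ltW r0)// -sqrtr_sqr; exact: ler_wsqrtr.
Qed.

(** With [p, q = t + u, t - u] and [p q = 1], twice the difference of [cosh r] and [t] factors as
    [(e - p) (1 - q / e)]. The second factor is positive, so the comparison reduces to [p <= e]. *)
Lemma acosh_le (t r : R) : 1 <= t -> 0 < r ->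
  (acosh t <= r) = (t <= (expR r + (expR r)^-1) / 2).
Proof.
move=> t1 r0; set e := expR r; have e1 : 1 < e by rewrite expR_gt1.
have e0 : 0 < e by exact: expR_gt0.
set k := (e + e^-1) / 2.
have ee : e * e^-1 = 1 by rewrite mulfV// gt_eqF.
have ei1 : e^-1 < 1 by rewrite invf_lt1.
have ei0 : 0 < e^-1 by rewrite invr_gt0.
pose u := Num.sqrt (t ^+ 2 - 1).
have u0 : 0 <= u by exact: sqrtr_ge0.
have u2 : u ^+ 2 = t ^+ 2 - 1 by rewrite sqr_sqrtr// subr_ge0 expr_ge1// (le_trans ler01).
have -> : (acosh t <= r) = (t + u <= e).
  by rewrite -[r in LHS]expRK ler_ln// posrE ltr_wpDr// (lt_le_trans ltr01).
have kE : k * 2 = e + e^-1 by rewrite /k divfK.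
move: ee ei1 ei0 kE; set f := e^-1 => ee ei1 ei0 kE.
pose p := t + u; pose q := t - u.
have pq : p * q = 1 by rewrite /p /q mulrC -subr_sqr u2; ring.
have p1 : 1 <= p by rewrite /p; lra.
have q0 : 0 < q by rewrite -(pmulr_rgt0 _ (lt_le_trans ltr01 p1)) pq.
have q1 : q <= 1 by rewrite -pq ler_peMl// ltW.
have qf : 0 < 1 - q * f by rewrite subr_gt0 (le_lt_trans _ ei1)// ler_piMl// ltW.
have main : (k - t) * 2 = (e - p) * (1 - q * f).
  rewrite mulrBl kE (_ : (e - p) * (1 - q * f) = e - p - q * (e * f) + (p * q) * f); last by ring.
  by rewrite ee pq /p /q; ring.
by rewrite -subr_ge0 -[RHS]subr_ge0 -[RHS](pmulr_lge0 (x := 2))// main pmulr_lge0.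
Qed.

Lemma ball_origin g (r : R) : 0 < r -> exists rho, [/\ 0 < rho, curv R g * rho ^+ 2 < 1 &
  forall x : 'rV[R]_d, gball g 0 r x <-> sqn x <= rho ^+ 2].
Proof.
move=> r0; case: g => /=.
  by exists r; split=> // [|x]; [rewrite mul0r|exact: euclidean_ball_origin].
pose k := (expR r + (expR r)^-1) / 2.
have k1 : 1 < k.
  have := expR_gt0 r; have : 1 < expR r by rewrite expR_gt1.
  rewrite /k; set e := expR r => e1 e0; have ee : e * e^-1 = 1 by rewrite mulfV// gt_eqF.
  by rewrite ltr_pdivlMr// mul1r; nra.
have k0 : 0 < k by exact: lt_trans k1.
(* As [k = cosh r], this is [tanh r], the Klein radius of the ball. *)
pose rho := Num.sqrt (1 - (k ^+ 2)^-1).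
have k2 : 0 < 1 - (k ^+ 2)^-1 by rewrite subr_gt0 invf_lt1 ?exprn_gt0// expr_gt1// ltW.
have rho2 : rho ^+ 2 = 1 - (k ^+ 2)^-1 by rewrite sqr_sqrtr// ltW.
exists rho; split; first by rewrite sqrtr_gt0.
  by rewrite mul1r rho2 gtrBl invr_gt0 exprn_gt0.
move=> x; rewrite /gball /= dotv0l /sqn dotv0l -/(sqn x) subr0 !mul1r.
have key : sqn x < 1 -> (acosh (Num.sqrt (1 - sqn x))^-1 <= r) = (sqn x <= rho ^+ 2).
  move=> x1; have s0 : 0 < 1 - sqn x by rewrite subr_gt0.
  have q0 : 0 < Num.sqrt (1 - sqn x) by rewrite sqrtr_gt0.
  have q1 : Num.sqrt (1 - sqn x) <= 1.
    by rewrite -[leRHS]sqrtr1 ler_wsqrtr// gerBl sqn_ge0.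
  rewrite acosh_le// -/k ?invf_ge1// rho2.
  rewrite -(@ler_pXn2r _ 2)// ?nnegrE ?invr_ge0 ?(ltW q0) ?(ltW k0)//.
  rewrite exprVn sqr_sqrtr ?(ltW s0)// -[k ^+ 2 in LHS]invrK.
  rewrite lef_pV2 ?posrE ?invr_gt0 ?exprn_gt0//.
  by rewrite lerBrDr addrC -lerBrDr.
split=> [[x1]|h]; first by rewrite key.
have x1 : sqn x < 1 by rewrite (le_lt_trans h)// rho2 gtrBl invr_gt0 exprn_gt0.
by split; rewrite ?key.
Qed.

End balls.

(** * Integrals of boxes *)

Section iint_box.
Variable R : realType.

Lemma measurable_indic_itv (a b : R) d (T : measurableType d) (f : T -> R) :
  measurable_fun setT f -> measurable_fun setT (fun t => \1_(`[a, b]%classic : set R) (f t) : R).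
Proof.
move=> mf; apply: (@measurableT_comp _ _ _ _ _ _ (\1_(`[a, b]%classic : set R) : R -> R)) => //.
Qed.

Definition box (a b : R) n (s : 'rV[R]_n) : R :=
  \prod_i \1_(`[a, b]%classic : set R) (s 0 i).

Lemma measurable_box a b n : measurable_real_on_rV (@box a b n).
Proof.
by move=> d T h mh; apply: measurable_prod => i _; apply: measurable_indic_itv; exact: mh.
Qed.

Lemma box_ge0 a b n (s : 'rV[R]_n) : 0 <= box a b s.
Proof. by apply: prodr_ge0 => i _; rewrite indicE. Qed.

Lemma box_cons a b n x (v : 'rV[R]_n) :
  @box a b n.+1 (row_mx x%:M v) = \1_(`[a, b]%classic : set R) x * box a b v.
Proof.
have h0 : (row_mx x%:M v : 'rV[R]_n.+1) 0 ord0 = x.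
  by rewrite -[RHS](row_mx_head x v 0); congr (_ 0 _); exact/val_inj.
have hS i : (row_mx x%:M v : 'rV[R]_n.+1) 0 (lift ord0 i) = v 0 i.
  by rewrite -[RHS](row_mx_tail x v i); congr (_ 0 _); exact/val_inj.
rewrite /box big_ord_recl h0; congr (_ * _).
by apply: eq_bigr => i _; rewrite hS.
Qed.

Lemma iint_box a b n : a <= b ->
  iint (fun s : 'rV[R]_n => (box a b s)%:E) = ((b - a) ^+ n)%:E.
Proof.
move=> ab; elim: n => [|n IH] /=; first by rewrite /box big_ord0.
have e x (v : 'rV[R]_n) : (@box a b n.+1 (row_mx x%:M v))%:E =
    ((\1_(`[a, b]%classic : set R) x)%:E * (box a b v)%:E)%E.
  rewrite -EFinM; congr (_%:E); exact: box_cons.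
under eq_integral => x _.
  under [X in iint X]eq_fun do rewrite e.
  rewrite iintZl; [|by rewrite indicE| |]; last 2 first.
  - by move=> d T h mh; apply/measurable_EFinP; exact: measurable_box.
  - by move=> v; rewrite lee_fin box_ge0.
  rewrite IH muleC; over.
rewrite ge0_integralZl_EFin//; last 2 first.
- by apply/measurable_EFinP; exact: measurable_indic.
- by rewrite exprn_ge0// subr_ge0.
rewrite integral_indic// setIT /= lebesgue_measure_itv /= lte_fin.
case: ltgtP ab => // [ab _|<- _]; first by rewrite -EFinB -EFinM exprSr.
by rewrite mule0 subrr exprS mul0r.
Qed.

End iint_box.

(** * The integral of the regular simplex *)

Section minimum.
Variables (R : realType) (g : geometry) (d : nat) (rho : R).
Hypotheses (d0 : (0 < d)%N) (rho0 : 0 < rho).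
Local Notation n := (d.+1%:R : R).
Implicit Types (w : 'I_d.+1 -> 'rV[R]_d) (s : 'rV[R]_(1 + d)).

Let curv_ge0 : 0 <= curv R g. Proof. by case: g. Qed.

Definition sums s := \sum_i s 0 i.

(** The value of [q] at [s W] for vertices with the Gram matrix [gram rho], expressed without
    choosing them. *)
Definition regular_qform s : R :=
  sums s ^+ 2 - curv R g * (d%:R * rho ^+ 2 * (n * sqn s - sums s ^+ 2)).

Lemma qform_vmx w s : qform g (s *m vmx w) =
  sums s ^+ 2 - curv R g * \sum_i \sum_j s 0 i * s 0 j * dotv (w i) (w j).
Proof.
rewrite /qform hd_mul_vmx tl_mul_vmx; congr (_ - _ * _).
rewrite /sqn dotv_suml; apply: eq_bigr => i _.
rewrite dotv_sumr; apply: eq_bigr => j _.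
by rewrite dotvZl dotvZr mulrA.
Qed.

Lemma sqnE s : sqn s = \sum_i s 0 i ^+ 2.
Proof. by rewrite /sqn dotvE; apply: eq_bigr => i _; rewrite expr2. Qed.

Lemma sums_sqr_le s : sums s ^+ 2 <= n * sqn s.
Proof.
have := dotv_CauchySchwarz s (const_mx 1).
have -> : sqn (const_mx 1 : 'rV[R]_(1 + d)) = n.
  by rewrite sqnE; under eq_bigr do rewrite mxE expr1n; rewrite sumr_const card_ord.
rewrite mulrC; congr (_ ^+ 2 <= _); rewrite dotvE.
by apply: eq_bigr => i _; rewrite mxE mulr1.
Qed.

Lemma sqn_le_sums s : (forall i, 0 <= s 0 i) -> sqn s <= sums s ^+ 2.
Proof.
move=> s0; rewrite sqnE expr2 {1}/sums mulr_suml; apply: ler_sum => i _.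
rewrite expr2 ler_wpM2l// /sums (bigD1 i)//= lerDl sumr_ge0//.
Qed.

Lemma gram_qform w s : gram rho w -> qform g (s *m vmx w) = regular_qform s.
Proof.
move=> gw; rewrite qform_vmx /regular_qform; congr (_ - _ * _).
pose K := d%:R * rho ^+ 2.
have e i : \sum_j s 0 i * s 0 j * dotv (w i) (w j) = K * (n * s 0 i ^+ 2 - s 0 i * sums s).
  rewrite (bigD1 i)//= gw eqxx {1}/sums [in RHS](bigD1 i)//= -/K.
  rewrite (eq_bigr (fun j => - (K * s 0 i) * s 0 j)) => [|j ji].
    by rewrite -mulr_sumr; ring.
  by rewrite gw eq_sym (negbTE ji) -/K mulr0; ring.
under eq_bigr do rewrite e.
by rewrite -mulr_sumr sumrB -mulr_sumr -mulr_suml sqnE expr2.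
Qed.

(** The average involves the trace [T] of the Gram matrix with weight [n |s|^2 - (sum s)^2], and its
    total sum, which is [|sum w_i|^2], with weight [(sum s)^2 - |s|^2]. Both weights are nonnegative
    for [s] in the orthant, so the total sum is dropped and [T] is bounded by [sum_sqn_ge]; the
    regular simplex loses nothing in either step. *)
Lemma qform_symmetrization w s : vmx w \in unitmx -> contains_ball rho w ->
  (forall i, 0 <= s 0 i) ->
  \sum_(p : 'S_(1 + d)) qform g (s *m perm_mx p *m vmx w) <=
  #|{: 'S_(1 + d)}|%:R * regular_qform s.
Proof.
move=> uw wB s0; pose N : R := #|{: 'S_(1 + d)}|%:R.
have dR : 0 < d%:R :> R by rewrite ltr0n.
have n0 : 0 < n by rewrite ltr0n.
pose G i j := dotv (w i) (w j).
have -> : \sum_(p : 'S_(1 + d)) qform g (s *m perm_mx p *m vmx w) =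
    \sum_(p : 'S_d.+1) (sums s ^+ 2 - curv R g *
      \sum_i \sum_j s 0 (p i) * s 0 (p j) * G i j).
  rewrite (reindex_inj invg_inj) /=; apply: eq_bigr => p _.
  have e i : (s *m perm_mx (p^-1)%g) 0 i = s 0 (p i) by rewrite -col_permE mxE.
  rewrite qform_vmx; congr (_ ^+ 2 - _ * _).
    rewrite /sums; under eq_bigr do rewrite e.
    by rewrite -(reindex_inj (@perm_inj _ p) (P := predT) (F := fun i => s 0 i)).
  by apply: eq_bigr => i _; apply: eq_bigr => j _; rewrite !e.
have cst (a : R) : \sum_(p : 'S_d.+1) a = N * a by rewrite sumr_const mulr_natl.
rewrite sumrB cst -mulr_sumr /regular_qform mulrBr -/N lerB// mulrCA ler_wpM2l//.
have q := perm_quadratic (fun i => s 0 i) G.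
rewrite -/N -(sqnE s) -/(sums s) in q.
have nd : 0 < n * d%:R by rewrite mulr_gt0.
rewrite -(ler_pM2l nd) q.
have trG : n * d%:R ^+ 2 * rho ^+ 2 <= \sum_i G i i := sum_sqn_ge rho0 uw wB.
have GG : 0 <= \sum_i \sum_j G i j.
  have := sqn_ge0 (\sum_i w i); rewrite /sqn dotv_suml.
  by under eq_bigr do rewrite dotv_sumr.
have h1 := sums_sqr_le s; have h2 := sqn_le_sums s0.
rewrite mulrCA ler_wpM2l ?ler0n//.
have nE : n = 1 + d%:R by rewrite -natr1 addrC.
set T := \sum_i G i i in trG *; set GS := \sum_i \sum_j G i j in GG *.
set P := sums s ^+ 2 in h1 h2 *; set S2 := sqn s in h1 h2 *.
apply: (@le_trans _ _ ((n * S2 - P) * T)).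
  rewrite (_ : n * d%:R * _ = (n * S2 - P) * (n * d%:R ^+ 2 * rho ^+ 2)); last by ring.
  by rewrite ler_wpM2l// subr_ge0.
rewrite (_ : (n * S2 - P) * T = d%:R * S2 * T + (P - S2) * (0 - T)); last by rewrite nE; ring.
by rewrite lerD2l ler_wpM2l ?subr_ge0// lerB.
Qed.

Lemma measurable_qform_vmx w : measurable_real_on_rV (fun s => qform g (s *m vmx w)).
Proof. by move=> d' T h mh; apply: measurable_qform; exact: measurable_row_mul. Qed.

Lemma measurable_regular_qform : measurable_real_on_rV regular_qform.
Proof.
have [w gw] := gram_exists d0 rho0.
move=> d' T h mh; under eq_fun do rewrite -(gram_qform _ gw).
exact: measurable_qform_vmx.
Qed.

Definition regular_integral := orthant_integral regular_qform.

Lemma regular_integral_le w : vmx w \in unitmx -> contains_ball rho w ->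
  (regular_integral <= orthant_integral (fun s => qform g (s *m vmx w)))%E.
Proof.
move=> uw wB; apply: (@orthant_integral_symmetrization R (1 + d)).
- exact: measurable_qform_vmx.
- exact: measurable_regular_qform.
- by move=> s s0; exact: qform_symmetrization.
Qed.

Lemma regular_qform_le s : regular_qform s <= sums s ^+ 2.
Proof.
rewrite gerBl mulr_ge0// mulr_ge0 ?subr_ge0 ?sums_sqr_le//.
by rewrite mulr_ge0 ?sqr_ge0.
Qed.

Lemma regular_qform_ge s : (forall i, 0 <= s 0 i) ->
  (1 - curv R g * (d%:R ^+ 2 * rho ^+ 2)) * sums s ^+ 2 <= regular_qform s.
Proof.
move=> s0; rewrite mulrBl mul1r lerB// -[leRHS]mulrA ler_wpM2l//.
rewrite (_ : d%:R ^+ 2 * rho ^+ 2 * _ = d%:R * rho ^+ 2 * (d%:R * sums s ^+ 2)); last by ring.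
have K0 : 0 <= d%:R * rho ^+ 2 by rewrite mulr_ge0 ?sqr_ge0.
rewrite ler_wpM2l//.
have nE : n = d%:R + 1 by rewrite natr1.
have dR := ler0n R d; have := sqn_le_sums s0; rewrite nE; nra.
Qed.

(** The hypothesis says that the regular vertices, of norm [d rho], lie in the model. It bounds [q]
    below by a positive multiple of [(sum s)^2] on the orthant, so the integrand has bounded support
    there. *)
Lemma regular_integral_fin : curv R g * (d%:R ^+ 2 * rho ^+ 2) < 1 ->
  exists2 I : R, 0 < I & regular_integral = I%:E.
Proof.
set k := 1 - curv R g * (d%:R ^+ 2 * rho ^+ 2).
rewrite -subr_gt0 -/k => k0.
have mO := measurable_orthant_hinge measurable_regular_qform.
have mB a b : measurable_on_rV (fun s => (@box R a b (1 + d) s)%:E).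
  by move=> d' T h mh; apply/measurable_EFinP; exact: measurable_box.
have boxE a b s : box a b s = [forall i, a <= s 0 i <= b]%R%:R.
  rewrite /box; case: forallP => [h|/forallP].
    by rewrite big1// => i _; rewrite indicE mem_setE in_itv /= h.
  rewrite negb_forall => /existsP[i hi].
  by rewrite (bigD1 i)//= indicE mem_setE in_itv /= (negbTE hi) mul0r.
have up : (regular_integral < +oo)%E.
  (* If some coordinate exceeds [M], then [(sum s)^2 >= 1 / k], hence [q >= 1] and the hinge
     vanishes. *)
  pose M := 1 + k^-1.
  have M0 : 0 <= M by rewrite addr_ge0// invr_ge0 ltW.
  apply: (@le_lt_trans _ _ (iint (fun s : 'rV[R]_(1 + d) => (box 0 M s)%:E))); last first.
    by rewrite iint_box// ltry.
  apply: le_iint => // [s|s]; first exact: orthant_hinge_ge0.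
  rewrite lee_fin orthantP; case: forallP => [s0|_]; last by rewrite mul0r box_ge0.
  have P0 : 0 <= sums s by exact: sumr_ge0.
  have q0 := regular_qform_ge s0; rewrite -/k in q0.
  have [b1|b1] := boolP [forall i, 0 <= s 0 i <= M].
    rewrite boxE b1 mulr_ile1 ?ler0n ?hinge_ge0//; first by case: (_ && _).
    by rewrite hinge_le1// (le_trans _ q0)// mulr_ge0 ?sqr_ge0 ?ltW.
  suff -> : hinge (regular_qform s) = 0 by rewrite mulr0 box_ge0.
  move: b1; rewrite negb_forall => /existsP[i]; rewrite s0 /= -ltNge => Ms.
  rewrite /hinge max_l// subr_le0 (le_trans _ q0)//.
  have sP : s 0 i <= sums s by rewrite /sums (bigD1 i)//= lerDl sumr_ge0.
  have kk : k * k^-1 = 1 by rewrite mulfV// gt_eqF.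
  have : k^-1 <= sums s ^+ 2.
    have ki : 0 < k^-1 by rewrite invr_gt0.
    rewrite expr2; move: Ms; rewrite /M => Ms; nra.
  by move=> h; rewrite -kk ler_pM2l.
have low : (0 < regular_integral)%E.
  (* Coordinates up to [e] have sum at most [1/2], so [q <= 1/4] and the hinge exceeds [1/2]. *)
  pose e : R := (2 * n)^-1; have n0 : 0 < n by rewrite ltr0n.
  have e0 : 0 < e by rewrite invr_gt0 mulr_gt0.
  have e2 : e / 2 < e by rewrite ltr_pdivrMr// ltr_pMr// ltr1n.
  apply: (@lt_le_trans _ _ (iint (fun s : 'rV[R]_(1 + d) => ((2^-1)%:E * (box (e / 2) e s)%:E)%E))).
    rewrite iintZl// ?iint_box ?ltW// -?EFinM ?lte_fin ?mulr_gt0 ?exprn_gt0 ?subr_gt0//.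
    by move=> s; rewrite lee_fin box_ge0.
  apply: le_iint => // [d' T h mh|s|s].
  - by apply: measurable_funeM; exact: mB.
  - by rewrite -EFinM lee_fin mulr_ge0 ?box_ge0.
  rewrite -EFinM lee_fin boxE; case: forallP => [se|_]; last first.
    by rewrite mulr0 mulr_ge0 ?orthant_ge0 ?hinge_ge0.
  have s0 i : 0 < s 0 i by have /andP[h _] := se i; rewrite (lt_le_trans _ h)// divr_gt0.
  have sP : 0 < sums s.
    by rewrite /sums big_ord_recl ltr_wpDr// sumr_ge0// => i _; exact: ltW.
  rewrite orthantP -/(sums s) sP andbT.
  rewrite (_ : [forall i, 0 <= s 0 i]); last by apply/forallP => i; exact: ltW.
  rewrite mulr1 mul1r /hinge le_max; apply/orP; right.
  have : sums s <= 2^-1.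
    apply: (@le_trans _ _ (\sum_(i < 1 + d) e)).
      by apply: ler_sum => i _; have /andP[] := se i.
    by rewrite sumr_const card_ord -[e *+ _]mulr_natl /e invfM mulrCA mulfV ?mulr1 ?gt_eqF.
  have := regular_qform_le s; rewrite expr2; nra.
move: up low; case: regular_integral => [I| |] //.
by rewrite lte_fin => _ I0; exists I.
Qed.

End minimum.

(** * The minimum *)

Section main.
Variables (R : realType) (g : geometry) (d : nat).
Hypothesis d0 : (0 < d)%N.
Implicit Types (v w : 'I_d.+1 -> 'rV[R]_d) (c x : 'rV[R]_d).
Local Notation n := (d.+1%:R : R).

Lemma barycentric_weights w t : vmx w \in unitmx -> is_weights t ->
  forall i, hd (coface w i) + dotv (convex_comb w t) (tl (coface w i)) = t i.
Proof.
by move=> uw [_ t1] i; rewrite -barycentricE -row_mul_vmx// mulmxK// mxE.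
Qed.

Lemma simplex_setP w x : vmx w \in unitmx ->
  simplex_set w x <-> forall i, 0 <= hd (coface w i) + dotv x (tl (coface w i)).
Proof.
move=> uw; split=> [/mem_set|h].
  by rewrite simplex_setE// => /forallP h i; rewrite -barycentricE.
by apply/set_mem; rewrite simplex_setE//; apply/forallP => i; rewrite barycentricE.
Qed.

Section ball.
Variables (r rho : R) (rho0 : 0 < rho).
Hypothesis ballE : forall x, gball g 0 r x <-> sqn x <= rho ^+ 2.

Lemma contains_ballP w : vmx w \in unitmx ->
  gball g 0 r `<=` simplex_set w <-> contains_ball rho w.
Proof.
move=> uw; split=> [h x /ballE /h /(simplex_setP _ uw)//|h x /ballE xr].
by apply/simplex_setP => //; exact: h.
Qed.

Lemma circumscribedP w : vmx w \in unitmx ->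
  circumscribed w (gball g 0 r) <-> contains_ball rho w /\ touches_ball rho w.
Proof.
move=> uw; split=> [[/(contains_ballP uw) wB wT]|[wB wT]].
  split=> // i; have [x [[t [wt [ti ->]]] /ballE xr]] := wT i.
  by exists (convex_comb w t); rewrite barycentric_weights.
have wB' := (contains_ballP uw).2 wB.
split=> // i; have [x [xr xi]] := wT i.
have xb : gball g 0 r x by apply/ballE.
exists x; split=> //; have [t [wt xt]] := wB' _ xb.
by exists t; split=> //; split=> //; rewrite -(barycentric_weights uw wt) -xt.
Qed.

(** In the hyperbolic case the vertices have [sum |w_i|^2 < n], against the lower bound
    [n d^2 rho^2]. So the regular simplex about the ball exists in the model as soon as any simplex
    contains the ball. *)
Lemma contains_ball_curv w : is_simplex g w -> contains_ball rho w ->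
  curv R g * (d%:R ^+ 2 * rho ^+ 2) < 1.
Proof.
move=> [ws wf] wB; have uw : vmx w \in unitmx by rewrite vmx_unit.
have := sum_sqn_ge rho0 uw wB.
case: g ws => /= ws h; first by rewrite mul0r.
rewrite mul1r -(@ltr_pM2l _ n) ?ltr0n// mulr1 mulrA (le_lt_trans h)//.
have -> : n = \sum_(i < d.+1) 1 by rewrite sumr_const card_ord.
by apply: ltr_sum => //; apply/hasP; exists ord0; rewrite ?mem_index_enum.
Qed.

Lemma gram_is_simplex w : curv R g * (d%:R ^+ 2 * rho ^+ 2) < 1 -> gram rho w ->
  is_simplex g w.
Proof.
move=> k gw; split; last by rewrite -vmx_unit; exact: (gram_unit d0 rho0).
by move=> i; apply/in_space_curv; rewrite (gram_sqn gw) subr_gt0.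
Qed.

(** A minimal simplex is compared with one having the Gram matrix [gram rho]. Cancelling the
    constants [C] and [I] leaves the reverse determinant inequality, whose equality case gives the
    Gram matrix. *)
Lemma minimal_gram v : is_simplex g v -> contains_ball rho v ->
  (forall w, is_simplex g w -> contains_ball rho w ->
    (gvol g (simplex_set v) <= gvol g (simplex_set w))%E) <-> gram rho v.
Proof.
move=> sv vB; have uv : vmx v \in unitmx by rewrite vmx_unit; case: sv.
have k1 := contains_ball_curv sv vB.
have [C C0 rC] := radial1 R d.
have [I I0 IE] := regular_integral_fin d0 rho0 k1.
pose B := (d%:R * rho ^+ 2) ^+ d * n ^+ d.+1.
have lower w : is_simplex g w -> contains_ball rho w ->
    ((`|\det (vmx w)| * I)%:E <= C%:E * gvol g (simplex_set w))%E.
  move=> sw wB; have uw : vmx w \in unitmx by rewrite vmx_unit; case: sw.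
  rewrite (cone_volume rC sw) EFinM -IE lee_wpmul2l// ?lee_fin//.
  exact: regular_integral_le.
have exact_gram w : gram rho w ->
    (C%:E * gvol g (simplex_set w) = (`|\det (vmx w)| * I)%:E)%E.
  move=> gw; rewrite (cone_volume rC (gram_is_simplex k1 gw)) EFinM -IE.
  by congr (_ * orthant_integral _)%E; apply/funext => s; exact: gram_qform.
have detB w : gram rho w -> `|\det (vmx w)| ^+ 2 = B.
  by move=> gw; rewrite real_normK ?num_real// (gram_det d0 rho0).
have le_det (a b : R) : 0 <= a -> 0 <= b -> (a <= b) = (a ^+ 2 <= b ^+ 2).
  by move=> a0 b0; rewrite ler_pXn2r.
split=> [vmin|gv w sw wB].
  have [w gw] := gram_exists d0 rho0.
  have sw := gram_is_simplex k1 gw.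
  have /(lee_wpmul2l (ltW C0 : (0 <= C%:E)%E)) := vmin w sw (gram_contains_ball d0 rho0 gw).
  move=> /(le_trans (lower v sv vB)); rewrite exact_gram// lee_fin ler_pM2r// le_det//.
  rewrite (detB w)// real_normK ?num_real//.
  exact: (det_vmx_bound d0 rho0 uv vB).2.
have uw : vmx w \in unitmx by rewrite vmx_unit; case: sw.
rewrite -(@lee_pmul2l _ C%:E)// exact_gram// (le_trans _ (lower w sw wB))//.
rewrite lee_fin ler_pM2r// le_det// detB// real_normK ?num_real//.
exact: (det_vmx_bound d0 rho0 uw wB).1.
Qed.

Lemma gram_regular_circumscribed v : rho < 1 \/ g = Euclidean -> is_simplex g v ->
  gram rho v <-> regular g v /\ circumscribed v (gball g 0 r).
Proof.
move=> rho1 [vs vf]; have uv : vmx v \in unitmx by rewrite vmx_unit.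
split=> [gv|[rv /(circumscribedP uv)[vB vT]]].
  split; first exact: gram_regular.
  by apply/(circumscribedP uv); split; [exact: gram_contains_ball|exact: gram_touches_ball].
case: g rv vs rho1 => rv vs [rho1|gE] //.
- exact: euclidean_regular_gram.
- exact: euclidean_regular_gram.
- exact: hyperbolic_regular_gram.
Qed.

Lemma minimal_at_origin v : rho < 1 \/ g = Euclidean -> is_simplex g v ->
  gball g 0 r `<=` simplex_set v ->
  (forall w, is_simplex g w -> gball g 0 r `<=` simplex_set w ->
     (gvol g (simplex_set v) <= gvol g (simplex_set w))%E)
  <-> (regular g v /\ circumscribed v (gball g 0 r)).
Proof.
move=> rho1 sv vB; have uv : vmx v \in unitmx by rewrite vmx_unit; case: sv.
have vB' := (contains_ballP uv).1 vB.
rewrite -gram_regular_circumscribed// -minimal_gram//.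
split=> h w sw wB; apply: h => //; have uw : vmx w \in unitmx by rewrite vmx_unit; case: sw.
  exact/(contains_ballP uw).
exact/(contains_ballP uw).
Qed.

End ball.

(** * Transport along isometries *)

Section transfer.
Variables (c c' : 'rV[R]_d) (r : R) (L L' : 'M[R]_(1 + d)) (T T' : 'rV[R]_d -> 'rV[R]_d).
Hypotheses (isoT : isometry_by g L T) (isoT' : isometry_by g L' T').
Hypotheses (cs : in_space g c) (cs' : in_space g c') (Tc : T c = c') (Tc' : T' c' = c).
Hypotheses (TK : forall x, in_space g x -> T' (T x) = x).
Hypotheses (TK' : forall x, in_space g x -> T (T' x) = x).

Lemma transfer_contains v : is_simplex g v ->
  gball g c r `<=` simplex_set v -> gball g c' r `<=` simplex_set (T \o v).
Proof.
move=> [vs _] vB x xB; have [xs _] := xB.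
rewrite -[x]TK'//; apply: (isometry_simplex_set isoT vs); apply: vB.
by rewrite -Tc'; exact: (isometry_ball isoT' cs' xB).
Qed.

Lemma transfer_circumscribed v : is_simplex g v ->
  circumscribed v (gball g c r) -> circumscribed (T \o v) (gball g c' r).
Proof.
move=> sv [vB vT]; split; first exact: transfer_contains.
move=> j; have [x [xf xB]] := vT j; exists (T x); split.
  by case: sv => vs _; exact: (isometry_facet isoT vs xf).
by rewrite -Tc; exact: (isometry_ball isoT cs xB).
Qed.

End transfer.

Definition minimal c r v := forall w, is_simplex g w -> gball g c r `<=` simplex_set w ->
  (gvol g (simplex_set v) <= gvol g (simplex_set w))%E.

(** A competitor for the ball about [c'] is pulled back by [T'] to a competitor of the same volume
    for the ball about [c]. *)
Lemma transfer_minimal c c' r L L' T T' v :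
  isometry_by g L T -> isometry_by g L' T' -> in_space g c' -> T c = c' -> T' c' = c ->
  in_space g c ->
  (forall x, in_space g x -> T' (T x) = x) -> (forall x, in_space g x -> T (T' x) = x) ->
  is_simplex g v -> minimal c r v -> minimal c' r (T \o v).
Proof.
move=> iT iT' cs' Tc Tc' cs TK TK' sv vmin w sw wB.
rewrite (isometry_volume iT sv) -(isometry_volume iT' sw).
apply: vmin; first exact: (isometry_simplex iT').
exact: (transfer_contains iT' iT cs Tc TK).
Qed.

End main.

Theorem mainTheorem6 (R : realType) (g : geometry) (d : nat) (hd : (2 <= d)%N)
    (c : 'rV[R]_d) (r : R) (hc : in_space g c) (hr : 0 < r)
    (v : 'I_d.+1 -> 'rV[R]_d) (hv : is_simplex g v)
    (hB : gball g c r `<=` simplex_set v) :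
  (forall w : 'I_d.+1 -> 'rV[R]_d, is_simplex g w ->
     gball g c r `<=` simplex_set w -> (gvol g (simplex_set v) <= gvol g (simplex_set w))%E)
  <-> (regular g v /\ circumscribed v (gball g c r)).
Proof.
have d0 : (0 < d)%N by exact: ltnW.
have [rho [rho0 rho1 ballE]] := ball_origin d g hr.
have rho1' : rho < 1 \/ g = Euclidean.
  move: rho0 rho1; clear; case: g => /= rho0; first by right.
  by rewrite mul1r expr_lt1 ?ltW//; left.
have [L [L' [T [T' [iT iT' Tc TK TK']]]]] := isometry_to_origin hc.
have o_in : in_space g (0 : 'rV[R]_d) by rewrite -Tc; exact: (isometry_in_space iT).
have Tc' : T' 0 = c by rewrite -Tc TK.
have sTv := isometry_simplex iT hv.
have TvB := transfer_contains iT iT' o_in Tc' TK' hv hB.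
have vE : T' \o (T \o v) = v by apply/funext => i /=; rewrite TK//; case: hv.
have main := minimal_at_origin d0 rho0 ballE rho1' sTv TvB.
split=> [vmin|[rv cv]].
  have [rTv cTv] := main.1 (transfer_minimal iT iT' o_in Tc Tc' hc TK TK' hv vmin).
  rewrite -vE; split; first by apply: (isometry_regular iT') => //; case: sTv.
  exact: (transfer_circumscribed iT' iT o_in hc Tc' Tc TK).
rewrite -vE; apply: (transfer_minimal iT' iT hc Tc' Tc o_in TK' TK sTv).
apply: main.2; split; first by apply: (isometry_regular iT) => //; case: hv.
exact: (transfer_circumscribed iT iT' hc o_in Tc Tc' TK').
Qed.
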